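(* Let $0<d<\pi/2$ and $\psi(\zeta)=\exp\left(\frac{\pi}{2}\sinh\zeta\right)$. Assume that $f$ is analytic in $\psi(\mathscr{D}_d)$ and that there exist positive constants $K,\alpha,\beta$ such that $|f(z)|\le K|E_2(z;\alpha,\beta)|$ for all $z\in\psi(\mathscr{D}_d)$. Let $\mu=\min\{\alpha,\beta\}$ and $\nu=\max\{\alpha,\beta\}$. For a positive integer $n$ let $h=\frac{\log(4dn/\mu)}{n}$, and let $M,N$ be defined by $M=n,\ N=n-\lfloor\log(\beta/\alpha)/h\rfloor$ if $\mu=\alpha$, and $N=n,\ M=n-\lfloor\log(\alpha/\beta)/h\rfloor$ if $\mu=\beta$. Let $n$ be sufficiently large that $n\ge(\nu\mathrm{e})/(4d)$. Then $$\sup_{t\in(0,\infty)}\left|f(t)-\sum_{k=-M}^{N}f(\psi(kh))\,S(k,h)(\psi^{-1}(t))\right|\le C_2\,\mathrm{e}^{-\pi dn/\log(4dn/\mu)},$$ where $C_2$ is the constant independent of $n$ given by $$C_2=\frac{2K}{\pi d\mu}\left\{\frac{4}{\pi(1-\mathrm{e}^{-\pi\mu\mathrm{e}/2})\{\cos(\frac{\pi}{2}\sin d)\}^{(\alpha+\beta)/2}\cos d}+\mu\,\mathrm{e}^{\pi\nu/4}\right\}.$$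
   Context: For $d>0$: $\mathscr{D}_d=\{\zeta\in\mathbb{C}:|\operatorname{Im}\zeta|<d\}$. The Sinc function is $S(k,h)(x)=\frac{\sin[\pi(x/h-k)]}{\pi(x/h-k)}$ (with value $1$ at $x=kh$). $E_2(z;\alpha,\beta)=\frac{z^{\alpha}}{(1+z^2)^{(\alpha+\beta)/2}}$, so $|E_2(z;\alpha,\beta)|=|z|^{\alpha}/|1+z^2|^{(\alpha+\beta)/2}$. $\psi^{-1}$ is the inverse of $\psi:\mathbb{R}\to(0,\infty)$. Convention: $\psi(\mathscr{D}_d)$ is regarded as an (infinitely sheeted) Riemann surface. Thus ''$f$ is analytic in $\psi(\mathscr{D}_d)$'' means that $F(\zeta)=f(\psi(\zeta))$ is an analytic function on $\mathscr{D}_d$ (with $f(t)=F(\psi^{-1}(t))$ for $t\in(0,\infty)$), and a bound on $|f(z)|$ for all $z\in\psi(\mathscr{D}_d)$ means the bound on $|F(\zeta)|$ with $z=\psi(\zeta)$, for all $\zeta\in\mathscr{D}_d$. *)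

(* Defs.v *)
From Stdlib Require Import Reals Lra Lia ZArith ClassicalEpsilon.
From Coquelicot Require Import Coquelicot.
Open Scope R_scope.

Definition strip (d : R) (zeta : C) : Prop := Rabs (Im zeta) < d.

Definition Cexp (z : C) : C :=
  (exp (Re z) * cos (Im z), exp (Re z) * sin (Im z)).

Definition Csinh (z : C) : C := ((Cexp z - Cexp (- z)) / RtoC 2)%C.

Definition Cpsi (zeta : C) : C := Cexp (RtoC (PI / 2) * Csinh zeta)%C.

Definition psi (x : R) : R := exp (PI / 2 * sinh x).

(* Total on R, meaningful for t > 0 (see psi_psi_inv and psi_inv_psi). *)
Definition psi_inv (t : R) : R :=
  epsilon (inhabits 0) (fun x : R => psi x = t).

(* The modulus of E_2(z; alpha, beta) = z^alpha / (1 + z^2)^((alpha+beta)/2).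
   The exponents are real, so it does not depend on the branches of the
   powers.  Rpower is only meaningful for a positive base, which is the case
   for z = Cpsi zeta with |Im zeta| < PI / 2: then z <> 0 and 1 + z^2 <> 0. *)
Definition normE2 (alpha beta : R) (z : C) : R :=
  Rpower (Cmod z) alpha
  / Rpower (Cmod (RtoC 1 + z * z)%C) ((alpha + beta) / 2).

Definition sinc (k : Z) (h x : R) : R :=
  if Req_EM_T x (IZR k * h) then 1
  else sin (PI * (x / h - IZR k)) / (PI * (x / h - IZR k)).

(* u a + u (a + 1) + ... + u b, which is 0 when b < a. *)
Definition Zsum (a b : Z) (u : Z -> C) : C :=
  sum_n_m (fun i : nat => u (a + Z.of_nat i - 1)%Z) 1 (Z.to_nat (b - a + 1)).

Definition step (d mu : R) (n : nat) : R := ln (4 * d * INR n / mu) / INR n.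

(* The supremum over t in (0, infinity), as an extended real. *)
Definition sup_pos (g : R -> R) : Rbar :=
  Lub_Rbar (fun y : R => exists t : R, 0 < t /\ y = g t).

Definition C2 (d K alpha beta : R) : R :=
  let mu := Rmin alpha beta in
  let nu := Rmax alpha beta in
  2 * K / (PI * d * mu) *
  (4 / (PI * (1 - exp (- (PI * mu * exp 1 / 2)))
        * Rpower (cos (PI / 2 * sin d)) ((alpha + beta) / 2)
        * cos d)
   + mu * exp (PI * nu / 4)).

Lemma psi_pos (x : R) : 0 < psi x.
Proof. apply exp_pos. Qed.

Lemma psi_psi_inv (t : R) : 0 < t -> psi (psi_inv t) = t.
Proof.
  intros Ht; unfold psi_inv; apply epsilon_spec.
  exists (arcsinh (2 / PI * ln t)); unfold psi; rewrite sinh_arcsinh.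
  replace (PI / 2 * (2 / PI * ln t)) with (ln t)
    by (field; exact PI_neq0).
  now apply exp_ln.
Qed.

Lemma psi_inv_psi (x : R) : psi_inv (psi x) = x.
Proof.
  assert (H := psi_psi_inv (psi x) (psi_pos x)).
  unfold psi in H at 1 3; apply exp_inv in H.
  assert (HP := PI_RGT_0).
  apply Rmult_eq_reg_l in H; [|lra].
  rewrite <- (arcsinh_sinh x) at 2; rewrite <- H.
  now rewrite arcsinh_sinh.
Qed.

Lemma Cpsi_RtoC (x : R) : Cpsi (RtoC x) = RtoC (psi x).
Proof.
  assert (HS : Csinh (RtoC x) = RtoC (sinh x)).
  { unfold Csinh, Cexp, RtoC, sinh; simpl.
    rewrite Ropp_0, cos_0, sin_0.
    unfold Cdiv, Cmult, Cminus, Cplus, Copp, Cinv; simpl.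
    f_equal; field. }
  unfold Cpsi; rewrite HS, <- RtoC_mult.
  unfold Cexp, psi, RtoC; simpl.
  rewrite cos_0, sin_0; f_equal; ring.
Qed.

(* Main.v *)
Require Import Defs.
From Stdlib Require Import Reals ZArith Lra Lia.
From Coquelicot Require Import Coquelicot.
Open Scope R_scope.

(* With mu = min(alpha, beta), the growth hypothesis becomes
   |F(x + iy)| <= A exp(-kappa |sinh x|) on the strip, kappa = (pi/2) mu cos d:
   writing psi(zeta) = e^w with w = u + iv, one has
   |E_2| = e^((alpha - beta) u / 2) / |2 cosh w|^((alpha + beta) / 2), and
   |cosh w| >= cosh u cos((pi/2) sin|y|).

   For the full sinc series, F(x) - sum_{|k| <= m} F(kh) S(k,h)(x) equals
   sin(pi x/h) / (2 pi i) times the integral of F(z) / ((z - x) sin(pi z/h))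
   around the rectangle with vertices +-(m + 1/2)h +- ic, c < d.  The vertical
   sides vanish as m grows; on the horizontal ones |sin(pi z/h)| >= sinh(pi c/h),
   and exp(-kappa |sinh t|) <= cosh t exp(-kappa |sinh t|) has an explicit
   integral.  Letting c tend to d gives the first term of C_2.

   The terms with k < -M or k > N are summed by comparison with the telescoping
   series of exp(-(pi/2) beta sinh(kh)); the choice of M and N makes
   alpha e^(Mh) and beta e^(Nh) both at least 4dn, which gives the second term.
   F is only assumed complex differentiable, so Cauchy's theorem is needed in
   Goursat's form, for rectangles. *)

(** * Contour integrals over rectangles and Goursat's theorem *)

(** The delicate estimate is |cosh w| >= cosh u cos a with a = (pi/2) sin|y|. Since v = (pi/2) cosh
    x sin y is unbounded, cos v has no positive lower bound; from |cosh w|^2 = cosh^2 u - sin^2 v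
    the claim becomes |sin v| <= cosh u sin a, with equality at x = 0. Several poles are handled by
    cutting the large rectangle with vertical lines into rectangles holding one pole each. Write L =
    log(4dn/mu), so nh = L and e^(-pi d/h) = e^(-pi dn/L). The inequality log y <= y/e gives pi d/h
    >= pi mu e/4, and 1/sinh then leaves the factor 1 - e^(-pi mu e/2). The tails live on the real
    line, where v = 0, so their term carries no cosine. They are of order e^(-pi dn); the condition
    n >= nu e/(4d) gives L >= 1, which brings them to the common exponential, and it also keeps the
    shorter cut-off nonnegative. *)

Definition Cdiff (F : C -> C) (z : C) : Prop :=
  exists l : C, @is_derive C_AbsRing C_NormedModule F z l.

(** Turns the filter-based derivative into a remainder estimate in [Cmod], the form in which
    Goursat's argument and the derivatives of 1/z and of the sine are handled. *)
Lemma is_derive_C_iff (F : C -> C) (z l : C) :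
  @is_derive C_AbsRing C_NormedModule F z l <->
  (forall eps, 0 < eps -> exists delta, 0 < delta /\ forall w,
     Cmod (w - z) < delta ->
     Cmod (F w - F z - l * (w - z)) <= eps * Cmod (w - z)).
Proof.
split.
- intros [_ H] eps Heps.
  destruct (H z (fun P HP => HP) (mkposreal _ Heps)) as [delta Hd].
  exists delta; split; [apply delta|].
  intros w Hw; specialize (Hd w Hw); cbn in Hd.
  replace (l * (w - z))%C with ((w - z) * l)%C by ring.
  exact Hd.
- intros H; split; [apply is_linear_scal_l|].
  intros x Hx; apply (is_filter_lim_locally_unique (V := AbsRing_NormedModule C_AbsRing)) in Hx; subst x.
  intros eps; destruct (H eps (cond_pos eps)) as [delta [Hd0 Hd]].
  exists (mkposreal _ Hd0); intros w Hw; specialize (Hd w Hw).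
  replace (l * (w - z))%C with ((w - z) * l)%C in Hd by ring.
  exact Hd.
Qed.

Definition Ccont (F : C -> C) (z : C) : Prop :=
  forall eps, 0 < eps -> exists delta, 0 < delta /\ forall w,
    Cmod (w - z) < delta -> Cmod (F w - F z) < eps.

Lemma Cdiff_cont (F : C -> C) (z : C) : Cdiff F z -> Ccont F z.
Proof.
intros [l Hl]; rewrite is_derive_C_iff in Hl; intros eps Heps.
destruct (Hl 1 Rlt_0_1) as [d [Hd H]].
assert (Hp : 0 < 1 + Cmod l) by (generalize (Cmod_ge_0 l); lra).
exists (Rmin d (eps / (1 + Cmod l))); split.
{ apply Rmin_pos; auto; now apply Rdiv_lt_0_compat. }
intros w Hw.
assert (H1 : Cmod (w - z) < d) by (eapply Rlt_le_trans; [apply Hw|apply Rmin_l]).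
assert (H2 : Cmod (w - z) < eps / (1 + Cmod l))
  by (eapply Rlt_le_trans; [apply Hw|apply Rmin_r]).
specialize (H w H1).
replace (F w - F z)%C with ((F w - F z - l * (w - z)) + l * (w - z))%C by ring.
eapply Rle_lt_trans; [apply Cmod_triangle|].
rewrite Cmod_mult.
apply Rlt_div_r in H2; lra.
Qed.

(** Here [C] is a normed module over the reals, so that an integral is a pair of real integrals,
    whereas derivatives are taken over [C_AbsRing]. *)
Definition CInt (f : R -> C) (a b : R) : C :=
  @RInt C_R_CompleteNormedModule f a b.
Definition ex_CInt (f : R -> C) (a b : R) : Prop :=
  @ex_RInt C_R_NormedModule f a b.
Definition is_CInt (f : R -> C) (a b : R) (l : C) : Prop :=
  @is_RInt C_R_NormedModule f a b l.

Lemma is_CInt_CInt f a b : ex_CInt f a b -> is_CInt f a b (CInt f a b).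
Proof. exact (@RInt_correct C_R_CompleteNormedModule f a b). Qed.

Lemma is_CInt_unique f a b l : is_CInt f a b l -> CInt f a b = l.
Proof. exact (@is_RInt_unique C_R_CompleteNormedModule f a b l). Qed.

Lemma is_CInt_pair f a b (u v : R) :
  is_RInt (fun t => fst (f t)) a b u -> is_RInt (fun t => snd (f t)) a b v ->
  is_CInt f a b (u, v).
Proof. exact (@is_RInt_fct_extend_pair R_NormedModule R_NormedModule f a b u v). Qed.

Lemma CInt_Chasles f a b c : ex_CInt f a b -> ex_CInt f b c ->
  (CInt f a b + CInt f b c)%C = CInt f a c.
Proof. exact (@RInt_Chasles C_R_CompleteNormedModule f a b c). Qed.

Lemma CInt_minus f g a b : ex_CInt f a b -> ex_CInt g a b ->
  CInt (fun t => f t - g t)%C a b = (CInt f a b - CInt g a b)%C.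
Proof. exact (@RInt_minus C_R_CompleteNormedModule f g a b). Qed.

(** The norm of a product of two real lines is Euclidean, so the general norm estimates for
    integrals become estimates of the modulus. *)
Lemma norm_C_R (z : C) : @norm R_AbsRing C_R_NormedModule z = Cmod z.
Proof.
destruct z as [x y]; unfold norm, Cmod; simpl.
unfold prod_norm; simpl; unfold norm; simpl; unfold abs; simpl.
now rewrite !Rmult_1_r, <- !Rabs_mult, !(Rabs_pos_eq (_ * _)) by apply Rle_0_sqr.
Qed.

Lemma Cmod_CInt_le f (g : R -> R) a b lg : a <= b -> ex_CInt f a b ->
  (forall x, a <= x <= b -> Cmod (f x) <= g x) -> is_RInt g a b lg ->
  Cmod (CInt f a b) <= lg.
Proof.
intros Hab Hf Hfg Hg.
rewrite <- norm_C_R.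
refine (@norm_RInt_le C_R_NormedModule f g a b _ lg Hab _ (is_CInt_CInt _ _ _ Hf) Hg).
intros x Hx; rewrite norm_C_R; auto.
Qed.

Lemma Cmod_CInt_le_const f a b M : a <= b -> ex_CInt f a b ->
  (forall x, a <= x <= b -> Cmod (f x) <= M) ->
  Cmod (CInt f a b) <= (b - a) * M.
Proof.
intros Hab Hf HM.
rewrite <- norm_C_R.
refine (@norm_RInt_le_const C_R_NormedModule f a b _ M Hab _ (is_CInt_CInt _ _ _ Hf)).
intros x Hx; rewrite norm_C_R; auto.
Qed.

Lemma ex_CInt_path (F : C -> C) (g : R -> C) a b : a <= b ->
  (forall s t, Cmod (g s - g t) <= Rabs (s - t)) ->
  (forall t, a <= t <= b -> Ccont F (g t)) ->
  ex_CInt (fun t => F (g t)) a b.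
Proof.
intros Hab Hg HF.
apply (@ex_RInt_continuous C_R_CompleteNormedModule).
rewrite Rmin_left, Rmax_right by lra.
intros t Ht; apply filterlim_locally; intros eps.
destruct (HF t Ht eps (cond_pos eps)) as [d [Hd H]].
exists (mkposreal d Hd); intros s Hs.
apply C_NormedModule_mixin_compat1.
apply H; eapply Rle_lt_trans; [apply Hg|exact Hs].
Qed.

Lemma Cmod_le_abs (z : C) : Cmod z <= Rabs (fst z) + Rabs (snd z).
Proof.
destruct z as [x y]; simpl.
replace (x, y) with (RtoC x + Ci * RtoC y)%C
  by (unfold RtoC, Ci, Cplus, Cmult; simpl; f_equal; ring).
eapply Rle_trans; [apply Cmod_triangle|].
rewrite Cmod_mult, Cmod_Ci, !Cmod_R; lra.
Qed.

Lemma abs_fst_le_Cmod (z : C) : Rabs (fst z) <= Cmod z.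
Proof. eapply Rle_trans; [|apply Rmax_Cmod]; apply Rmax_l. Qed.

Lemma abs_snd_le_Cmod (z : C) : Rabs (snd z) <= Cmod z.
Proof. eapply Rle_trans; [|apply Rmax_Cmod]; apply Rmax_r. Qed.

Lemma ex_CInt_h (F : C -> C) y a b : a <= b ->
  (forall x, a <= x <= b -> Ccont F (x, y)) ->
  ex_CInt (fun t => F (t, y)) a b.
Proof.
intros Hab HF; apply (ex_CInt_path F (fun t => (t, y))); auto.
intros s t; eapply Rle_trans; [apply Cmod_le_abs|]; simpl.
replace (y + - y) with 0 by ring; rewrite Rabs_R0; unfold Rminus; lra.
Qed.

Lemma ex_CInt_v (F : C -> C) x c e : c <= e ->
  (forall y, c <= y <= e -> Ccont F (x, y)) ->
  ex_CInt (fun t => F (x, t)) c e.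
Proof.
intros Hab HF; apply (ex_CInt_path F (fun t => (x, t))); auto.
intros s t; eapply Rle_trans; [apply Cmod_le_abs|]; simpl.
replace (x + - x) with 0 by ring; rewrite Rabs_R0; unfold Rminus; lra.
Qed.

(** The contour integral around [a, b] x [c, e], counterclockwise; [Ci] is dz/dt on the vertical
    sides. *)
Definition rect (F : C -> C) (a b c e : R) : C :=
  (CInt (fun t => F (t, c)) a b - CInt (fun t => F (t, e)) a b
   + Ci * (CInt (fun t => F (b, t)) c e - CInt (fun t => F (a, t)) c e))%C.

Lemma rect_split_x F a b b' c e :
  ex_CInt (fun t => F (t, c)) a b -> ex_CInt (fun t => F (t, c)) b b' ->
  ex_CInt (fun t => F (t, e)) a b -> ex_CInt (fun t => F (t, e)) b b' ->
  rect F a b' c e = (rect F a b c e + rect F b b' c e)%C.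
Proof.
intros; unfold rect.
rewrite <- (CInt_Chasles (fun t => F (t, c)) a b b') by auto.
rewrite <- (CInt_Chasles (fun t => F (t, e)) a b b') by auto.
ring.
Qed.

Lemma rect_split_y F a b c e e' :
  ex_CInt (fun t => F (a, t)) c e -> ex_CInt (fun t => F (a, t)) e e' ->
  ex_CInt (fun t => F (b, t)) c e -> ex_CInt (fun t => F (b, t)) e e' ->
  rect F a b c e' = (rect F a b c e + rect F a b e e')%C.
Proof.
intros; unfold rect.
rewrite <- (CInt_Chasles (fun t => F (a, t)) c e e') by auto.
rewrite <- (CInt_Chasles (fun t => F (b, t)) c e e') by auto.
ring.
Qed.

Definition boundary (a b c e : R) (z : C) : Prop :=
  (a <= fst z <= b /\ (snd z = c \/ snd z = e)) \/
  (c <= snd z <= e /\ (fst z = a \/ fst z = b)).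

Ltac bdry := unfold boundary; simpl; tauto || lra || (left; lra) || (right; lra).

Lemma rect_bound F a b c e M : a <= b -> c <= e ->
  (forall z, boundary a b c e z -> Ccont F z) ->
  (forall z, boundary a b c e z -> Cmod (F z) <= M) ->
  Cmod (rect F a b c e) <= 2 * ((b - a) + (e - c)) * M.
Proof.
intros Hab Hce HF HM; unfold rect.
eapply Rle_trans; [apply Cmod_triangle|].
rewrite Cmod_mult, Cmod_Ci, Rmult_1_l.
unfold Cminus.
eapply Rle_trans; [apply Rplus_le_compat; apply Cmod_triangle|].
rewrite !Cmod_opp.
assert (H1 : Cmod (CInt (fun t => F (t, c)) a b) <= (b - a) * M).
{ apply Cmod_CInt_le_const; auto; [apply ex_CInt_h; auto|]; intros; [apply HF|apply HM]; bdry. }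
assert (H2 : Cmod (CInt (fun t => F (t, e)) a b) <= (b - a) * M).
{ apply Cmod_CInt_le_const; auto; [apply ex_CInt_h; auto|]; intros; [apply HF|apply HM]; bdry. }
assert (H3 : Cmod (CInt (fun t => F (b, t)) c e) <= (e - c) * M).
{ apply Cmod_CInt_le_const; auto; [apply ex_CInt_v; auto|]; intros; [apply HF|apply HM]; bdry. }
assert (H4 : Cmod (CInt (fun t => F (a, t)) c e) <= (e - c) * M).
{ apply Cmod_CInt_le_const; auto; [apply ex_CInt_v; auto|]; intros; [apply HF|apply HM]; bdry. }
lra.
Qed.

Lemma rect_minus F G a b c e : a <= b -> c <= e ->
  (forall z, boundary a b c e z -> Ccont F z) ->
  (forall z, boundary a b c e z -> Ccont G z) ->
  rect (fun z => F z - G z)%C a b c e = (rect F a b c e - rect G a b c e)%C.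
Proof.
intros Hab Hce HF HG; unfold rect.
rewrite (CInt_minus (fun t => F (t, c)) (fun t => G (t, c)))
  by (apply ex_CInt_h; auto; intros; (apply HF || apply HG); bdry).
rewrite (CInt_minus (fun t => F (t, e)) (fun t => G (t, e)))
  by (apply ex_CInt_h; auto; intros; (apply HF || apply HG); bdry).
rewrite (CInt_minus (fun t => F (a, t)) (fun t => G (a, t)))
  by (apply ex_CInt_v; auto; intros; (apply HF || apply HG); bdry).
rewrite (CInt_minus (fun t => F (b, t)) (fun t => G (b, t)))
  by (apply ex_CInt_v; auto; intros; (apply HF || apply HG); bdry).
ring.
Qed.

Lemma is_RInt_affine (p q a b : R) :
  is_RInt (fun t => p + q * t) a b (p * (b - a) + q * (b ^ 2 - a ^ 2) / 2).
Proof.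
replace (p * (b - a) + q * (b ^ 2 - a ^ 2) / 2)
  with (minus (p * b + q * b ^ 2 / 2) (p * a + q * a ^ 2 / 2))
  by (unfold minus, plus, opp; simpl; field).
apply (is_RInt_derive (fun t => p * t + q * t ^ 2 / 2)).
- intros; auto_derive; auto; field.
- intros; apply (ex_derive_continuous (fun t => p + q * t)); auto_derive; auto.
Qed.

(** Explicit integration of both coordinates on each side. In Goursat's argument this removes the
    first-order part of F and leaves only the remainder. *)
Lemma rect_affine (A B : C) a b c e : rect (fun z => A + B * z)%C a b c e = RtoC 0.
Proof.
assert (Hh : forall y, CInt (fun t => A + B * (t, y))%C a b =
  ((fst A - snd B * y) * (b - a) + fst B * (b ^ 2 - a ^ 2) / 2,
   (snd A + fst B * y) * (b - a) + snd B * (b ^ 2 - a ^ 2) / 2)).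
{ intros y; apply is_CInt_unique, is_CInt_pair.
  - eapply is_RInt_ext; [|apply is_RInt_affine]; intros; simpl; ring.
  - eapply is_RInt_ext; [|apply is_RInt_affine]; intros; simpl; ring. }
assert (Hv : forall x, CInt (fun t => A + B * (x, t))%C c e =
  ((fst A + fst B * x) * (e - c) + (- snd B) * (e ^ 2 - c ^ 2) / 2,
   (snd A + snd B * x) * (e - c) + fst B * (e ^ 2 - c ^ 2) / 2)).
{ intros x; apply is_CInt_unique, is_CInt_pair.
  - eapply is_RInt_ext; [|apply is_RInt_affine]; intros; simpl; ring.
  - eapply is_RInt_ext; [|apply is_RInt_affine]; intros; simpl; ring. }
unfold rect; rewrite !Hh, !Hv.
unfold RtoC, Cplus, Cminus, Cmult, Copp, Ci; simpl; f_equal; field.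
Qed.

Section Quartering.

Variable F : C -> C.

Let J (p : R * R) (w l : R) : R :=
  Cmod (rect F (fst p) (fst p + w) (snd p) (snd p + l)).

(** Bisection step of Goursat's argument: the lower-left corner of a quarter whose boundary integral
    keeps at least a fourth of the modulus. The last quarter is a default, justified in
    [quarter_big]. *)
Definition quarter (p : R * R) (w l : R) : R * R :=
  let big q := Rle_dec (J p w l) (4 * J q (w / 2) (l / 2)) in
  let '(x, y) := p in
  if big (x, y) then (x, y) else
  if big (x + w / 2, y) then (x + w / 2, y) else
  if big (x, y + l / 2) then (x, y + l / 2) else (x + w / 2, y + l / 2).

Fixpoint corner (p : R * R) (w l : R) (k : nat) : R * R :=
  match k with
  | O => p
  | S k => quarter (corner p w l k) (w / 2 ^ k) (l / 2 ^ k)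
  end.

Lemma quarter_pos p w l : 0 <= w -> 0 <= l ->
  fst p <= fst (quarter p w l) /\ fst (quarter p w l) + w / 2 <= fst p + w /\
  snd p <= snd (quarter p w l) /\ snd (quarter p w l) + l / 2 <= snd p + l.
Proof.
intros Hw Hl; unfold quarter; destruct p as [x y].
repeat match goal with |- context [Rle_dec ?r ?s] => destruct (Rle_dec r s) end;
  simpl; lra.
Qed.

(** The integrals around the four quarters add up to the whole, so if three of them stay below a
    fourth in modulus, the triangle inequality leaves the default one. *)
Lemma quarter_big p w l : 0 <= w -> 0 <= l ->
  (forall z, fst p <= fst z <= fst p + w -> snd p <= snd z <= snd p + l -> Ccont F z) ->
  J p w l <= 4 * J (quarter p w l) (w / 2) (l / 2).
Proof.
intros Hw Hl HF; unfold quarter; destruct p as [x y]; simpl in HF.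
match goal with |- context [Rle_dec ?r ?s] => destruct (Rle_dec r s) as [|H1] end; auto.
match goal with |- context [Rle_dec ?r ?s] => destruct (Rle_dec r s) as [|H2] end; auto.
match goal with |- context [Rle_dec ?r ?s] => destruct (Rle_dec r s) as [|H3] end; auto.
apply Rnot_le_lt in H1, H2, H3.
unfold J in *; simpl in *.
assert (E : rect F x (x + w) y (y + l) =
  (rect F x (x + w / 2) y (y + l / 2) + rect F (x + w / 2) (x + w / 2 + w / 2) y (y + l / 2)
  + rect F x (x + w / 2) (y + l / 2) (y + l / 2 + l / 2)
  + rect F (x + w / 2) (x + w / 2 + w / 2) (y + l / 2) (y + l / 2 + l / 2))%C).
{ replace (x + w / 2 + w / 2) with (x + w) by field.
  replace (y + l / 2 + l / 2) with (y + l) by field.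
  rewrite (rect_split_x F x (x + w / 2) (x + w))
    by (apply ex_CInt_h; [lra|intros; apply HF; simpl; lra]).
  rewrite (rect_split_y F x (x + w / 2) y (y + l / 2) (y + l))
    by (apply ex_CInt_v; [lra|intros; apply HF; simpl; lra]).
  rewrite (rect_split_y F (x + w / 2) (x + w) y (y + l / 2) (y + l))
    by (apply ex_CInt_v; [lra|intros; apply HF; simpl; lra]).
  ring. }
rewrite E in *.
match goal with |- Cmod (?p + ?q + ?r + ?s) <= _ =>
  assert (G1 := Cmod_triangle (p + q + r) s);
  assert (G2 := Cmod_triangle (p + q) r);
  assert (G3 := Cmod_triangle p q) end.
lra.
Qed.

Variables (p : R * R) (w l : R).
Hypotheses (Hw : 0 <= w) (Hl : 0 <= l).

Lemma pow2_scaled_nonneg u k : 0 <= u -> 0 <= u / 2 ^ k.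
Proof.
intros; apply Rmult_le_pos; auto; left; apply Rinv_0_lt_compat, pow_lt; lra.
Qed.

Lemma corner_step k :
  fst (corner p w l k) <= fst (corner p w l (S k)) /\
  fst (corner p w l (S k)) + w / 2 ^ S k <= fst (corner p w l k) + w / 2 ^ k /\
  snd (corner p w l k) <= snd (corner p w l (S k)) /\
  snd (corner p w l (S k)) + l / 2 ^ S k <= snd (corner p w l k) + l / 2 ^ k.
Proof.
assert (Hk : 2 ^ k <> 0) by (apply pow_nonzero; lra).
replace (w / 2 ^ S k) with (w / 2 ^ k / 2) by (simpl; now field).
replace (l / 2 ^ S k) with (l / 2 ^ k / 2) by (simpl; now field).
apply quarter_pos; now apply pow2_scaled_nonneg.
Qed.

Lemma corner_nested j k : (j <= k)%nat ->
  fst (corner p w l j) <= fst (corner p w l k) /\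
  fst (corner p w l k) + w / 2 ^ k <= fst (corner p w l j) + w / 2 ^ j /\
  snd (corner p w l j) <= snd (corner p w l k) /\
  snd (corner p w l k) + l / 2 ^ k <= snd (corner p w l j) + l / 2 ^ j.
Proof.
induction 1 as [|k Hk IH]; [lra|].
generalize (corner_step k); lra.
Qed.

Lemma corner_big k :
  (forall z, fst p <= fst z <= fst p + w -> snd p <= snd z <= snd p + l -> Ccont F z) ->
  J p w l <= 4 ^ k * J (corner p w l k) (w / 2 ^ k) (l / 2 ^ k).
Proof.
intros HF; induction k as [|k IH].
{ simpl; rewrite !Rdiv_1_r; lra. }
assert (Hk : 2 ^ k <> 0) by (apply pow_nonzero; lra).
replace (w / 2 ^ S k) with (w / 2 ^ k / 2) by (simpl; now field).
replace (l / 2 ^ S k) with (l / 2 ^ k / 2) by (simpl; now field).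
eapply Rle_trans; [apply IH|].
simpl (4 ^ S k); rewrite (Rmult_comm 4), Rmult_assoc.
apply Rmult_le_compat_l; [apply pow_le; lra|].
apply quarter_big; try now apply pow2_scaled_nonneg.
destruct (corner_nested 0 k) as (H1 & H2 & H3 & H4); [lia|].
simpl in H1, H2, H3, H4; rewrite Rdiv_1_r in H2, H4.
intros z Hz1 Hz2; apply HF; lra.
Qed.

(** The supremum of the left ends works: by nesting, each right end is an upper bound of them. *)
Lemma nested_point (x v : nat -> R) :
  (forall k, 0 <= v k) ->
  (forall j k, (j <= k)%nat -> x j <= x k /\ x k + v k <= x j + v j) ->
  exists s, forall k, x k <= s <= x k + v k.
Proof.
intros Hv Hx.
assert (Hub : forall k, is_upper_bound (fun r => exists j, r = x j) (x k + v k)).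
{ intros k r [j ->].
  destruct (Nat.le_gt_cases j k) as [H|H].
  - generalize (proj1 (Hx _ _ H)) (Hv k); lra.
  - generalize (proj2 (Hx k j ltac:(lia))) (Hv j); lra. }
destruct (completeness (fun r => exists j, r = x j)) as [s [Hs1 Hs2]].
- exists (x O + v O); apply Hub.
- now exists (x O), O.
- exists s; intros k; split; [apply Hs1; now exists k|apply Hs2, Hub].
Qed.

End Quartering.

(** Bisection closes in on a point where F is differentiable. After k steps the remainder
    contributes at most a small constant times perimeter times diameter, of order 4^(-k), which
    cancels the factor 4^k lost by bisection. *)
Lemma goursat (F : C -> C) a b c e : a <= b -> c <= e ->
  (forall z, a <= fst z <= b -> c <= snd z <= e -> Cdiff F z) ->
  rect F a b c e = RtoC 0.
Proof.
intros Hab Hce HF.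
set (p := (a, c)); set (w := b - a); set (l := e - c).
assert (Hw : 0 <= w) by (unfold w; lra).
assert (Hl : 0 <= l) by (unfold l; lra).
assert (Hc : forall z, fst p <= fst z <= fst p + w -> snd p <= snd z <= snd p + l -> Cdiff F z).
{ intros z; simpl; unfold w, l; intros; apply HF; lra. }
destruct (nested_point (fun k => fst (corner F p w l k)) (fun k => w / 2 ^ k)) as [x Hx].
{ intros; now apply pow2_scaled_nonneg. }
{ intros j k Hjk; generalize (corner_nested F p w l Hw Hl j k Hjk); tauto. }
destruct (nested_point (fun k => snd (corner F p w l k)) (fun k => l / 2 ^ k)) as [y Hy].
{ intros; now apply pow2_scaled_nonneg. }
{ intros j k Hjk; generalize (corner_nested F p w l Hw Hl j k Hjk); tauto. }
assert (Hz : Cdiff F (x, y)).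
{ apply Hc; simpl; [generalize (Hx O)|generalize (Hy O)]; simpl; rewrite Rdiv_1_r; lra. }
destruct Hz as [D HD]; rewrite is_derive_C_iff in HD.
apply Cmod_eq_0; apply Rle_antisym; [|apply Cmod_ge_0].
apply Rle_plus_epsilon; intros eps Heps; rewrite Rplus_0_l.
(* 2 (w + l) is the perimeter and w + l bounds the diameter; the 1 keeps the quotient meaningful for
   a degenerate rectangle. *)
assert (HL : 0 < 1 + 2 * (w + l) * (w + l)) by nra.
destruct (HD (eps / (1 + 2 * (w + l) * (w + l)))) as [delta [Hd Hdelta]].
{ now apply Rdiv_lt_0_compat. }
assert (Hk : exists k, (w + l) / 2 ^ k < delta).
{ destruct (pow_lt_1_zero (/ 2)) with (y := delta / (1 + (w + l))) as [k Hk].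
  - rewrite Rabs_pos_eq; lra.
  - apply Rdiv_lt_0_compat; lra.
  - exists k; specialize (Hk k (Nat.le_refl _)).
    rewrite pow_inv in Hk.
    assert (H2 : 0 < / 2 ^ k) by (apply Rinv_0_lt_compat, pow_lt; lra).
    rewrite Rabs_pos_eq in Hk by lra.
    apply Rlt_div_r in Hk; [|lra].
    unfold Rdiv; nra. }
destruct Hk as [k Hk].
set (q := corner F p w l k).
set (wk := w / 2 ^ k); set (lk := l / 2 ^ k).
assert (H2k : 0 < 2 ^ k) by (apply pow_lt; lra).
assert (Hwk : 0 <= wk) by now apply pow2_scaled_nonneg.
assert (Hlk : 0 <= lk) by now apply pow2_scaled_nonneg.
assert (Hq := corner_nested F p w l Hw Hl 0 k ltac:(lia)).
fold q wk lk in Hq; simpl in Hq; rewrite !Rdiv_1_r in Hq.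
assert (Hqx := Hx k); fold q wk in Hqx.
assert (Hqy := Hy k); fold q lk in Hqy.
assert (HB := corner_big F p w l Hw Hl k (fun z h1 h2 => Cdiff_cont _ _ (Hc z h1 h2))).
cbv beta in HB; fold q wk lk in HB; unfold p in HB at 1 2 3 4; simpl fst in HB at 1 2; simpl snd in HB at 1 2.
replace (a + w) with b in HB by (unfold w; ring).
replace (c + l) with e in HB by (unfold l; ring).
eapply Rle_trans; [apply HB|].
(* [A + D * z] is the first-order expansion of F at the limit point. *)
set (A := (F (x, y) - D * (x, y))%C).
assert (Hcont : forall z, boundary (fst q) (fst q + wk) (snd q) (snd q + lk) z -> Ccont F z).
{ intros z Hz; apply Cdiff_cont, Hc; simpl; unfold boundary in Hz; lra. }
assert (Haff : forall z, Ccont (fun z => A + D * z)%C z).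
{ intros z; apply Cdiff_cont; exists D; apply is_derive_C_iff.
  intros ep Hep; exists 1; split; [lra|]; intros u _.
  replace (A + D * u - (A + D * z) - D * (u - z))%C with (RtoC 0) by ring.
  rewrite Cmod_0; apply Rmult_le_pos; [lra|apply Cmod_ge_0]. }
assert (Hsub : rect F (fst q) (fst q + wk) (snd q) (snd q + lk) =
  rect (fun z => F z - (A + D * z))%C (fst q) (fst q + wk) (snd q) (snd q + lk)).
{ rewrite rect_minus; auto; try lra.
  rewrite rect_affine; ring. }
rewrite Hsub; clear Hsub HB.
set (eps1 := eps / (1 + 2 * (w + l) * (w + l))) in *.
assert (He1 : 0 < eps1) by now apply Rdiv_lt_0_compat.
assert (Hsmall : Cmod (rect (fun z => F z - (A + D * z))%C (fst q) (fst q + wk) (snd q) (snd q + lk))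
  <= 2 * (wk + lk) * (eps1 * (wk + lk))).
{ replace (2 * (wk + lk)) with (2 * ((fst q + wk - fst q) + (snd q + lk - snd q))) by ring.
  apply rect_bound; try lra.
  - intros z Hz ep Hep.
    destruct (Hcont z Hz (ep / 2)) as [d1 [Hd1 G1]]; [lra|].
    destruct (Haff z (ep / 2)) as [d2 [Hd2 G2]]; [lra|].
    exists (Rmin d1 d2); split; [now apply Rmin_pos|].
    intros u Hu.
    specialize (G1 u (Rlt_le_trans _ _ _ Hu (Rmin_l _ _))).
    specialize (G2 u (Rlt_le_trans _ _ _ Hu (Rmin_r _ _))).
    replace (F u - (A + D * u) - (F z - (A + D * z)))%C with
     ((F u - F z) - ((A + D * u) - (A + D * z)))%C by ring.
    unfold Cminus at 1; eapply Rle_lt_trans; [apply Cmod_triangle|].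
    rewrite Cmod_opp; lra.
  - intros z Hz.
    assert (Hm : Cmod (z - (x, y)) <= wk + lk).
    { eapply Rle_trans; [apply Cmod_le_abs|]; destruct z as [zx zy]; simpl.
      unfold boundary in Hz; simpl in Hz.
      apply Rplus_le_compat; apply Rabs_le; lra. }
    replace (F z - (A + D * z))%C with (F z - F (x, y) - D * (z - (x, y)))%C
      by (unfold A; ring).
    eapply Rle_trans; [apply Hdelta|apply Rmult_le_compat_l; lra].
    eapply Rle_lt_trans; [apply Hm|].
    unfold wk, lk; replace (w / 2 ^ k + l / 2 ^ k) with ((w + l) / 2 ^ k) by (field; lra).
    exact Hk. }
eapply Rle_trans; [apply Rmult_le_compat_l; [apply pow_le; lra|apply Hsmall]|].
replace (4 ^ k * (2 * (wk + lk) * (eps1 * (wk + lk)))) with (eps1 * (2 * (w + l) * (w + l))).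
2:{ unfold wk, lk; replace 4 with (2 * 2) by ring; rewrite Rpow_mult_distr; field; lra. }
apply Rle_trans with (eps1 * (1 + 2 * (w + l) * (w + l))); [nra|].
unfold eps1; right; field; lra.
Qed.

(** * Simple poles and the complex sine *)

(** An antiderivative is 2 k atan((t - p) / s). Two opposite sides of a square centred at a pole
    produce this kernel, hence half a turn. *)
Lemma RInt_poisson_kernel k p s : 0 < s ->
  is_RInt (fun t => k * (2 * s / ((t - p) ^ 2 + s ^ 2))) (p - s) (p + s) (k * PI).
Proof.
intros Hs.
replace (k * PI) with (minus (2 * k * atan ((p + s - p) / s)) (2 * k * atan ((p - s - p) / s))).
2:{ replace ((p + s - p) / s) with 1 by (field; lra).
    replace ((p - s - p) / s) with (- (1)) by (field; lra).
    rewrite atan_opp, atan_1; unfold minus, plus, opp; simpl; field. }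
apply (is_RInt_derive (fun t => 2 * k * atan ((t - p) / s))).
- intros t _; auto_derive; auto.
  assert (0 <= (t - p) ^ 2) by apply pow2_ge_0.
  field; split; simpl in *; nra.
- intros t _; apply (ex_derive_continuous (fun t => k * (2 * s / ((t - p) ^ 2 + s ^ 2)))).
  auto_derive; auto.
  assert (0 <= (t - p) ^ 2) by apply pow2_ge_0; simpl in *; nra.
Qed.

(* C carries two NormedModule structures over C_AbsRing whose uniform structures
   are not convertible: the product and chain rules of Coquelicot use the first,
   the theorem the second. *)
Lemma is_derive_C_AbsRing_iff (f : C -> C) (z l : C) :
  @is_derive C_AbsRing (AbsRing_NormedModule C_AbsRing) f z l <->
  @is_derive C_AbsRing C_NormedModule f z l.
Proof.
split; intros [Hl H]; (split; [apply is_linear_scal_l|]);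
  intros x Hx eps; destruct (H x Hx eps) as [delta Hd];
  exists delta; intros w Hw; exact (Hd w Hw).
Qed.

Lemma Cdiff_div (f g : C -> C) (z : C) : Cdiff f z -> Cdiff g z -> g z <> RtoC 0 ->
  Cdiff (fun w => f w / g w)%C z.
Proof.
intros [df Hf] Hg0 Hgz.
assert (Hi : @is_derive C_AbsRing C_NormedModule Cinv (g z) (- (/ g z * / g z))%C).
{ apply is_derive_C_iff; intros eps Heps.
  set (a := g z) in *.
  assert (Ha : 0 < Cmod a) by now apply Cmod_gt_0.
  (* The first radius gives |w| >= |a|/2; the second then makes the remainder (w - a)^2 / (w a^2) at
     most eps |w - a|. *)
  exists (Rmin (Cmod a / 2) (eps * Cmod a ^ 3 / 2)); split.
  { apply Rmin_pos; [lra|].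
    assert (0 < Cmod a ^ 3) by now apply pow_lt. nra. }
  intros w Hw.
  assert (H1 := Rlt_le_trans _ _ _ Hw (Rmin_l _ _)).
  assert (H2 := Rlt_le_trans _ _ _ Hw (Rmin_r _ _)).
  assert (H3 : Cmod a / 2 <= Cmod w).
  { assert (T := Cmod_triangle w (a - w)).
    replace (w + (a - w))%C with a in T by ring.
    replace (a - w)%C with (- (w - a))%C in T by ring.
    rewrite Cmod_opp in T; lra. }
  assert (Hw0 : w <> RtoC 0) by (apply Cmod_gt_0; lra).
  replace (/ w - / a - - (/ a * / a) * (w - a))%C
    with ((w - a) * (w - a) * / (w * (a * a)))%C.
  2:{ field; repeat split; auto. }
  rewrite !Cmod_mult, Cmod_inv, !Cmod_mult.
  2:{ repeat (apply Cmult_neq_0; auto). }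
  rewrite Rmult_comm, <- Rmult_assoc.
  apply Rmult_le_compat_r; [apply Cmod_ge_0|].
  rewrite Rmult_comm; apply Rle_div_l.
  - assert (0 < Cmod a * Cmod a) by nra; nra.
  - apply Rlt_le; eapply Rlt_le_trans; [apply H2|].
    replace (eps * Cmod a ^ 3 / 2) with ((Cmod a / 2) * (eps * (Cmod a * Cmod a))) by field.
    replace (eps * (Cmod w * (Cmod a * Cmod a))) with (Cmod w * (eps * (Cmod a * Cmod a))) by ring.
    apply Rmult_le_compat_r; auto.
    apply Rmult_le_pos; nra. }
destruct Hg0 as [dg Hg].
eexists.
apply is_derive_C_AbsRing_iff, (is_derive_mult (K := C_AbsRing) f (fun w => Cinv (g w)) z).
- apply is_derive_C_AbsRing_iff, Hf.
- apply (is_derive_comp (K := C_AbsRing) (V := AbsRing_NormedModule C_AbsRing) Cinv g z);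
    apply is_derive_C_AbsRing_iff; eauto.
- exact Cmult_comm.
Qed.

Lemma Cdiff_mult (f g : C -> C) (z : C) : Cdiff f z -> Cdiff g z ->
  Cdiff (fun w => f w * g w)%C z.
Proof.
intros [df Hf] [dg Hg].
eexists; apply is_derive_C_AbsRing_iff, (is_derive_mult (K := C_AbsRing) f g z);
  try (apply is_derive_C_AbsRing_iff; eauto).
exact Cmult_comm.
Qed.

Lemma Cdiff_minus (f g : C -> C) (z : C) : Cdiff f z -> Cdiff g z ->
  Cdiff (fun w => f w - g w)%C z.
Proof.
intros [df Hf] [dg Hg].
eexists; apply (is_derive_minus (K := C_AbsRing) (V := C_NormedModule) f g); eauto.
Qed.

Lemma Cdiff_const (c z : C) : Cdiff (fun _ => c) z.
Proof. eexists; apply (is_derive_const (K := C_AbsRing) (V := C_NormedModule)). Qed.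

Lemma Cdiff_id (z : C) : Cdiff (fun w => w) z.
Proof. eexists; apply is_derive_C_AbsRing_iff, (is_derive_id (K := C_AbsRing)). Qed.

Lemma Cminus_neq_0 (z p : C) : z <> p -> (z - p)%C <> RtoC 0.
Proof.
intros H E; apply H.
replace z with (z - p + p)%C by ring; rewrite E; ring.
Qed.

(** Opposite sides are paired: bottom minus top is the Poisson kernel times i r, right minus left is
    the kernel times r, and each pair contributes pi i r to the contour integral. *)
Lemma rect_pole_square (p : C) s r : 0 < s ->
  rect (fun z => r / (z - p))%C (fst p - s) (fst p + s) (snd p - s) (snd p + s)
  = (RtoC (2 * PI) * Ci * r)%C.
Proof.
intros Hs; destruct p as [x y]; simpl fst; simpl snd.
assert (Hsq : forall t, 0 < t ^ 2 + s ^ 2) by (intros t; generalize (pow2_ge_0 t); nra).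
assert (Hd : forall z, z <> (x, y) -> Cdiff (fun z => r / (z - (x, y)))%C z).
{ intros z Hz; apply (Cdiff_div (fun _ => r) (fun z => z - (x, y))%C).
  - apply Cdiff_const.
  - apply Cdiff_minus; [apply Cdiff_id|apply Cdiff_const].
  - now apply Cminus_neq_0. }
unfold rect.
rewrite <- !CInt_minus.
2, 3: apply (ex_CInt_v (fun z => r / (z - (x, y)))%C); [lra|];
      intros t _; apply Cdiff_cont, Hd; intros E; injection E; lra.
2, 3: apply (ex_CInt_h (fun z => r / (z - (x, y)))%C); [lra|];
      intros t _; apply Cdiff_cont, Hd; intros E; injection E; lra.
assert (H1 : CInt (fun t => r / ((t, (y - s)%R) - (x, y)) - r / ((t, (y + s)%R) - (x, y)))%C
   (x - s) (x + s) = (RtoC PI * Ci * r)%C).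
{ apply is_CInt_unique.
  replace (RtoC PI * Ci * r)%C with ((- snd r) * PI, fst r * PI)
    by (unfold RtoC, Ci, Cmult; simpl; f_equal; ring).
  apply is_CInt_pair.
  - eapply is_RInt_ext; [|apply (RInt_poisson_kernel (- snd r) x s Hs)].
    intros t _; specialize (Hsq (t - x)).
    unfold Cmult, Cinv; simpl.
    field; simpl in Hsq; repeat split; nra.
  - eapply is_RInt_ext; [|apply (RInt_poisson_kernel (fst r) x s Hs)].
    intros t _; specialize (Hsq (t - x)).
    unfold Cmult, Cinv; simpl.
    field; simpl in Hsq; repeat split; nra. }
assert (H2 : CInt (fun t => r / (((x + s)%R, t) - (x, y)) - r / (((x - s)%R, t) - (x, y)))%C
   (y - s) (y + s) = (RtoC PI * r)%C).
{ apply is_CInt_unique.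
  replace (RtoC PI * r)%C with (fst r * PI, snd r * PI)
    by (unfold RtoC, Cmult; simpl; f_equal; ring).
  apply is_CInt_pair.
  - eapply is_RInt_ext; [|apply (RInt_poisson_kernel (fst r) y s Hs)].
    intros t _; specialize (Hsq (t - y)).
    unfold Cmult, Cinv; simpl.
    field; simpl in Hsq; repeat split; nra.
  - eapply is_RInt_ext; [|apply (RInt_poisson_kernel (snd r) y s Hs)].
    intros t _; specialize (Hsq (t - y)).
    unfold Cmult, Cinv; simpl.
    field; simpl in Hsq; repeat split; nra. }
rewrite H1, H2, RtoC_mult; ring.
Qed.

(** [r] is the residue, as the limit of (z - p) g(z); the point p itself is left out, and r = 0 is
    allowed. *)
Definition simple_pole (g : C -> C) (p r : C) : Prop :=
  forall eps, 0 < eps -> exists delta, 0 < delta /\ forall z,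
    z <> p -> Cmod (z - p) < delta -> Cmod ((z - p) * g z - r) <= eps.

Lemma simple_pole_div (A B : C -> C) (p b : C) : Ccont A p ->
  @is_derive C_AbsRing C_NormedModule B p b -> B p = RtoC 0 -> b <> RtoC 0 ->
  simple_pole (fun z => A z / B z)%C p (A p / b)%C.
Proof.
intros HA HB HB0 Hb eps Heps; rewrite is_derive_C_iff in HB.
assert (Hb1 : 0 < Cmod b) by now apply Cmod_gt_0.
assert (Hap := Cmod_ge_0 (A p)).
(* [eta] will bound |A z - A p| and |q - b| for q = B z / (z - p). The first entry keeps |q| >=
   |b|/2; the second makes the numerator error eta (|b| + |A p|) at most eps |b|^2 / 2 <= eps |q
   b|. *)
set (eta := Rmin (Cmod b / 2) (eps * Cmod b ^ 2 / (2 * (Cmod b + Cmod (A p))))).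
assert (Heta : 0 < eta).
{ apply Rmin_pos; [lra|]; apply Rdiv_lt_0_compat; [|lra].
  apply Rmult_lt_0_compat; [lra|now apply pow_lt]. }
assert (E1 : eta <= Cmod b / 2) by apply Rmin_l.
assert (E2 : eta * (2 * (Cmod b + Cmod (A p))) <= eps * Cmod b ^ 2).
{ apply Rle_div_r; [lra|apply Rmin_r]. }
destruct (HA eta Heta) as [d1 [Hd1 G1]].
destruct (HB eta Heta) as [d2 [Hd2 G2]].
exists (Rmin d1 d2); split; [now apply Rmin_pos|].
intros z Hz Hzd.
specialize (G1 z (Rlt_le_trans _ _ _ Hzd (Rmin_l _ _))).
specialize (G2 z (Rlt_le_trans _ _ _ Hzd (Rmin_r _ _))).
assert (Hzp := Cminus_neq_0 _ _ Hz).
set (q := (B z / (z - p))%C).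
assert (Hq : Cmod (q - b) <= eta).
{ replace (q - b)%C with ((B z - B p - b * (z - p)) / (z - p))%C
    by (unfold q; rewrite HB0; now field).
  rewrite Cmod_div by auto.
  apply Rle_div_l; auto; now apply Cmod_gt_0. }
assert (Hq2 : Cmod b / 2 <= Cmod q).
{ assert (T := Cmod_triangle q (b - q)).
  replace (q + (b - q))%C with b in T by ring.
  replace (b - q)%C with (- (q - b))%C in T by ring.
  rewrite Cmod_opp in T; lra. }
assert (Hq0 : q <> RtoC 0) by (apply Cmod_gt_0; lra).
assert (HBz : B z <> RtoC 0).
{ intros E; apply Hq0; unfold q; rewrite E; field; auto. }
replace ((z - p) * (A z / B z) - A p / b)%C
  with (((A z - A p) * b - A p * (q - b)) / (q * b))%C.
2:{ replace (A z / B z)%C with (A z / (q * (z - p)))%C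
      by (unfold q; field; auto).
    field; auto. }
rewrite Cmod_div by now apply Cmult_neq_0.
rewrite Cmod_mult; apply Rle_div_l; [nra|].
unfold Cminus at 1; eapply Rle_trans; [apply Cmod_triangle|].
rewrite Cmod_opp, !Cmod_mult.
apply Rle_trans with (eta * (Cmod b + Cmod (A p))); [nra|].
apply Rle_trans with (eps * Cmod b ^ 2 / 2); [lra|].
simpl; rewrite Rmult_1_r.
apply Rle_trans with (eps * ((Cmod b / 2) * Cmod b)); [lra|].
apply Rmult_le_compat_l; [lra|]; apply Rmult_le_compat_r; lra.
Qed.

(** Goursat's theorem on the four pieces around a small square moves the contour to that square, of
    half-side s. There g differs from r / (z - p) by at most eps / (8 s), and the perimeter is 8
    s. *)
Lemma rect_simple_pole (g : C -> C) (p r : C) a b c e :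
  a < fst p < b -> c < snd p < e ->
  (forall z, a <= fst z <= b -> c <= snd z <= e -> z <> p -> Cdiff g z) ->
  simple_pole g p r ->
  rect g a b c e = (RtoC (2 * PI) * Ci * r)%C.
Proof.
intros Hab Hce Hg Hp.
assert (Hc : forall z, a <= fst z <= b -> c <= snd z <= e -> z <> p -> Ccont g z)
  by (intros; apply Cdiff_cont; auto).
assert (Hne : forall z : C, (fst z <> fst p \/ snd z <> snd p) -> z <> p)
  by (intros z [H|H] E; apply H; now rewrite E).
assert (Hshrink : forall s, 0 < s -> a <= fst p - s -> fst p + s <= b ->
  c <= snd p - s -> snd p + s <= e ->
  rect g a b c e = rect g (fst p - s) (fst p + s) (snd p - s) (snd p + s)).
{ intros s Hs H1 H2 H3 H4.
  rewrite (rect_split_x g a (fst p - s) b)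
    by (apply ex_CInt_h; [lra|intros; apply Hc; simpl; try lra; apply Hne; simpl; lra]).
  rewrite (rect_split_x g (fst p - s) (fst p + s) b)
    by (apply ex_CInt_h; [lra|intros; apply Hc; simpl; try lra; apply Hne; simpl; lra]).
  rewrite (rect_split_y g (fst p - s) (fst p + s) c (snd p - s) e)
    by (apply ex_CInt_v; [lra|intros; apply Hc; simpl; try lra; apply Hne; simpl; lra]).
  rewrite (rect_split_y g (fst p - s) (fst p + s) (snd p - s) (snd p + s) e)
    by (apply ex_CInt_v; [lra|intros; apply Hc; simpl; try lra; apply Hne; simpl; lra]).
  rewrite (goursat g a (fst p - s)), (goursat g (fst p + s) b),
    (goursat g (fst p - s) (fst p + s) c), (goursat g (fst p - s) (fst p + s) (snd p + s) e);
    try lra; try (intros; apply Hg; try lra; apply Hne; lra).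
  ring. }
assert (Hz : (rect g a b c e - RtoC (2 * PI) * Ci * r)%C = RtoC 0).
{ apply Cmod_eq_0, Rle_antisym; [|apply Cmod_ge_0].
  apply Rle_plus_epsilon; intros eps Heps; rewrite Rplus_0_l.
  destruct (Hp (eps / 8)) as [delta [Hd Hdelta]]; [lra|].
  set (s := Rmin (delta / 3) (Rmin (Rmin (fst p - a) (b - fst p)) (Rmin (snd p - c) (e - snd p)))).
  assert (Hs : 0 < s) by (repeat apply Rmin_pos; lra).
  assert (Hsd : s <= delta / 3) by apply Rmin_l.
  assert (Hs1 : s <= Rmin (Rmin (fst p - a) (b - fst p)) (Rmin (snd p - c) (e - snd p)))
    by apply Rmin_r.
  assert (Hs2 := Rle_trans _ _ _ Hs1 (Rmin_l _ _)).
  assert (Hs3 := Rle_trans _ _ _ Hs1 (Rmin_r _ _)).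
  assert (Hs4 := Rle_trans _ _ _ Hs2 (Rmin_l _ _)).
  assert (Hs5 := Rle_trans _ _ _ Hs2 (Rmin_r _ _)).
  assert (Hs6 := Rle_trans _ _ _ Hs3 (Rmin_l _ _)).
  assert (Hs7 := Rle_trans _ _ _ Hs3 (Rmin_r _ _)).
  rewrite (Hshrink s) by lra.
  rewrite <- (rect_pole_square p s r Hs).
  assert (Hin : forall z, boundary (fst p - s) (fst p + s) (snd p - s) (snd p + s) z ->
    a <= fst z <= b /\ c <= snd z <= e /\ z <> p /\ s <= Cmod (z - p) < delta).
  { intros z Hz; unfold boundary in Hz; repeat split; try lra.
    - apply Hne; lra.
    - destruct Hz as [[_ H]|[_ H]].
      + eapply Rle_trans; [|apply abs_snd_le_Cmod]; destruct z, p; simpl in *.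
        destruct H as [-> | ->]; [rewrite Rabs_left|rewrite Rabs_pos_eq]; lra.
      + eapply Rle_trans; [|apply abs_fst_le_Cmod]; destruct z, p; simpl in *.
        destruct H as [-> | ->]; [rewrite Rabs_left|rewrite Rabs_pos_eq]; lra.
    - eapply Rle_lt_trans; [apply Cmod_le_abs|]; destruct z, p; simpl in *.
      apply Rle_lt_trans with (s + s); [|lra].
      apply Rplus_le_compat; apply Rabs_le; lra. }
  assert (Hk : forall z, z <> p -> Cdiff (fun z => r / (z - p))%C z).
  { intros z Hz; apply (Cdiff_div (fun _ => r) (fun z => z - p)%C).
    - apply Cdiff_const.
    - apply Cdiff_minus; [apply Cdiff_id|apply Cdiff_const].
    - now apply Cminus_neq_0. }
  rewrite <- rect_minus; try lra.
  2: intros z Hz; apply Hc; apply Hin in Hz; tauto.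
  2: intros z Hz; apply Cdiff_cont, Hk; apply Hin in Hz; tauto.
  replace eps with (2 * ((fst p + s - (fst p - s)) + (snd p + s - (snd p - s))) * (eps / 8 / s))
    by (field; lra).
  apply rect_bound; try lra.
  - intros z Hz; apply Hin in Hz; apply Cdiff_cont, (Cdiff_minus g (fun z => r / (z - p))%C);
     [apply Hg|apply Hk]; tauto.
  - intros z Hz; apply Hin in Hz; destruct Hz as (_ & _ & Hzp & Hs8 & Hs9).
    assert (Hzp' := Cminus_neq_0 _ _ Hzp).
    replace (g z - r / (z - p))%C with (((z - p) * g z - r) / (z - p))%C by (field; auto).
    rewrite Cmod_div by auto.
    unfold Rdiv at 1 2; apply Rmult_le_compat; [apply Cmod_ge_0| |now apply Hdelta|].
    + left; apply Rinv_0_lt_compat; lra.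
    + apply Rinv_le_contravar; lra. }
replace (rect g a b c e) with (rect g a b c e - RtoC (2 * PI) * Ci * r + RtoC (2 * PI) * Ci * r)%C
  by ring.
rewrite Hz; ring.
Qed.

Definition Csin (z : C) : C := (sin (fst z) * cosh (snd z), cos (fst z) * sinh (snd z)).
Definition Ccos (z : C) : C := (cos (fst z) * cosh (snd z), - (sin (fst z) * sinh (snd z))).

Lemma is_derive_R_at_0 (f : R -> R) (l : R) : is_derive f 0 l ->
  forall eps, 0 < eps -> exists delta, 0 < delta /\ forall t, Rabs t < delta ->
    Rabs (f t - f 0 - l * t) <= eps * Rabs t.
Proof.
intros [_ H] eps Heps.
destruct (H 0 (fun P HP => HP) (mkposreal _ Heps)) as [delta Hd].
exists delta; split; [apply delta|]; intros t Ht.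
specialize (Hd t); unfold ball in Hd; simpl in Hd.
unfold AbsRing_ball, norm, minus, plus, opp, scal, abs in Hd; simpl in Hd.
unfold mult in Hd; simpl in Hd.
replace (f t - f 0 - l * t) with (f t + - f 0 + - ((t + - 0) * l)) by ring.
replace t with (t + - 0) at 3 by ring.
apply Hd; now replace (t + - 0) with t by ring.
Qed.

Lemma is_derive_sinh x : is_derive sinh x (cosh x).
Proof. apply is_derive_Reals, derivable_pt_lim_sinh. Qed.

Lemma is_derive_cosh x : is_derive cosh x (sinh x).
Proof. apply is_derive_Reals, derivable_pt_lim_cosh. Qed.

(** Only the origin is treated by hand: the addition formula carries these expansions to every
    point. *)
Lemma Csin_Ccos_near_0 eps : 0 < eps -> exists delta, 0 < delta /\ forall w,
  Cmod w < delta ->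
  Cmod (Csin w - w) <= eps * Cmod w /\ Cmod (Ccos w - RtoC 1) <= eps * Cmod w.
Proof.
intros Heps0.
set (eps1 := Rmin 1 (eps / 8)).
assert (Heps : 0 < eps1) by (apply Rmin_pos; lra).
assert (Heps1 : eps1 <= 1) by apply Rmin_l.
assert (Heps8 : 8 * eps1 <= eps) by (generalize (Rmin_r 1 (eps / 8)); fold eps1; lra).
destruct (is_derive_R_at_0 sin 1) with (eps := eps1) as [d1 [Hd1 G1]]; auto.
{ generalize (is_derive_sin 0); now rewrite cos_0. }
destruct (is_derive_R_at_0 cos 0) with (eps := eps1) as [d2 [Hd2 G2]]; auto.
{ generalize (is_derive_cos 0); now rewrite sin_0, Ropp_0. }
destruct (is_derive_R_at_0 sinh 1) with (eps := eps1) as [d3 [Hd3 G3]]; auto.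
{ generalize (is_derive_sinh 0); now rewrite cosh_0. }
destruct (is_derive_R_at_0 cosh 0) with (eps := eps1) as [d4 [Hd4 G4]]; auto.
{ generalize (is_derive_cosh 0); now rewrite sinh_0. }
(* [eps1] itself is among the radii, so that products of two small quantities, such as b sin a, are
   at most a multiple of eps1 |w|. *)
set (d := Rmin eps1 (Rmin (Rmin d1 d2) (Rmin d3 d4))).
assert (Hd : 0 < d) by (repeat apply Rmin_pos; auto; lra).
exists d; split; auto; intros [a b] Hw.
assert (Ha : Rabs a <= Cmod (a, b)) by apply (abs_fst_le_Cmod (a, b)).
assert (Hb : Rabs b <= Cmod (a, b)) by apply (abs_snd_le_Cmod (a, b)).
assert (D0 : d <= eps1) by apply Rmin_l.
assert (D1 : d <= d1) by (eapply Rle_trans; [apply Rmin_r|]; eapply Rle_trans; [apply Rmin_l|]; apply Rmin_l).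
assert (D2 : d <= d2) by (eapply Rle_trans; [apply Rmin_r|]; eapply Rle_trans; [apply Rmin_l|]; apply Rmin_r).
assert (D3 : d <= d3) by (eapply Rle_trans; [apply Rmin_r|]; eapply Rle_trans; [apply Rmin_r|]; apply Rmin_l).
assert (D4 : d <= d4) by (eapply Rle_trans; [apply Rmin_r|]; eapply Rle_trans; [apply Rmin_r|]; apply Rmin_r).
specialize (G1 a ltac:(lra)); specialize (G2 a ltac:(lra)).
specialize (G3 b ltac:(lra)); specialize (G4 b ltac:(lra)).
rewrite sin_0 in G1; rewrite cos_0 in G2; rewrite sinh_0 in G3; rewrite cosh_0 in G4.
set (m := Cmod (a, b)) in *.
replace (sin a - 0 - 1 * a) with (sin a - a) in G1 by ring.
replace (cos a - 1 - 0 * a) with (cos a - 1) in G2 by ring.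
replace (sinh b - 0 - 1 * b) with (sinh b - b) in G3 by ring.
replace (cosh b - 1 - 0 * b) with (cosh b - 1) in G4 by ring.
assert (G1' : Rabs (sin a - a) <= eps1 * m) by nra.
assert (G2' : Rabs (cos a - 1) <= eps1 * m) by nra.
assert (G3' : Rabs (sinh b - b) <= eps1 * m) by nra.
assert (G4' : Rabs (cosh b - 1) <= eps1 * m) by nra.
assert (Ps : Rabs (sin a) <= 1) by (apply Rabs_le, SIN_bound).
assert (Pc : Rabs (cos a) <= 1) by (apply Rabs_le, COS_bound).
assert (M : 0 <= m) by apply Cmod_ge_0.
assert (Em : 0 <= eps1 * m) by nra.
split; (eapply Rle_trans; [apply Cmod_le_abs|]); simpl.
- replace (sin a * cosh b + - a) with (sin a * (cosh b - 1) + (sin a - a)) by ring.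
  replace (cos a * sinh b + - b) with (cos a * (sinh b - b) + b * (cos a - 1)) by ring.
  assert (T1 := Rabs_triang (sin a * (cosh b - 1)) (sin a - a)).
  assert (T2 := Rabs_triang (cos a * (sinh b - b)) (b * (cos a - 1))).
  rewrite Rabs_mult in T1; rewrite !Rabs_mult in T2.
  generalize (Rabs_pos (cosh b - 1)) (Rabs_pos (sin a)) (Rabs_pos (sinh b - b))
    (Rabs_pos (cos a)) (Rabs_pos b) (Rabs_pos (cos a - 1)); intros.
  assert (Rabs (sin a) * Rabs (cosh b - 1) <= eps1 * m) by nra.
  assert (Rabs (cos a) * Rabs (sinh b - b) <= eps1 * m) by nra.
  assert (Rabs b * Rabs (cos a - 1) <= eps1 * m) by nra.
  assert (8 * eps1 * m <= eps * m) by nra.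
  lra.
- replace (cos a * cosh b + - (1)) with (cos a * (cosh b - 1) + (cos a - 1)) by ring.
  replace (- (sin a * sinh b) + - 0) with (- (sin a * (sinh b - b) + b * ((sin a - a) + a))) by ring.
  rewrite Rabs_Ropp.
  assert (T1 := Rabs_triang (cos a * (cosh b - 1)) (cos a - 1)).
  assert (T2 := Rabs_triang (sin a * (sinh b - b)) (b * (sin a - a + a))).
  assert (T3 := Rabs_triang (sin a - a) a).
  rewrite Rabs_mult in T1; rewrite !Rabs_mult in T2.
  generalize (Rabs_pos (cosh b - 1)) (Rabs_pos (sin a)) (Rabs_pos (sinh b - b))
    (Rabs_pos (cos a)) (Rabs_pos b) (Rabs_pos (sin a - a + a)); intros.
  assert (Rabs (cos a) * Rabs (cosh b - 1) <= eps1 * m) by nra.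
  assert (Rabs (sin a) * Rabs (sinh b - b) <= eps1 * m) by nra.
  assert (Rabs (sin a - a + a) <= 2 * m) by nra.
  assert (Rabs b * Rabs (sin a - a + a) <= eps1 * (2 * m)) by (apply Rmult_le_compat; lra).
  assert (8 * eps1 * m <= eps * m) by nra.
  lra.
Qed.

Lemma sinh_plus a b : sinh (a + b) = sinh a * cosh b + cosh a * sinh b.
Proof. unfold sinh, cosh; rewrite Ropp_plus_distr, !exp_plus; field. Qed.

Lemma cosh_plus a b : cosh (a + b) = cosh a * cosh b + sinh a * sinh b.
Proof. unfold sinh, cosh; rewrite Ropp_plus_distr, !exp_plus; field. Qed.

Lemma Csin_plus z w : Csin (z + w) = (Csin z * Ccos w + Ccos z * Csin w)%C.
Proof.
destruct z as [a b], w as [u v]; unfold Csin, Ccos, Cplus, Cmult; simpl.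
rewrite sin_plus, cos_plus, sinh_plus, cosh_plus; f_equal; ring.
Qed.

Lemma is_derive_Csin (z : C) : @is_derive C_AbsRing C_NormedModule Csin z (Ccos z).
Proof.
apply is_derive_C_iff; intros eps Heps.
set (S := 1 + Cmod (Csin z) + Cmod (Ccos z)).
assert (HS : 0 < S) by (generalize (Cmod_ge_0 (Csin z)) (Cmod_ge_0 (Ccos z)); unfold S; lra).
destruct (Csin_Ccos_near_0 (eps / S)) as [d [Hd H]]; [now apply Rdiv_lt_0_compat|].
exists d; split; auto; intros w Hw; destruct (H _ Hw) as [H1 H2].
set (u := (w - z)%C) in *.
replace w with (z + u)%C by (unfold u; ring).
rewrite Csin_plus.
replace (Csin z * Ccos u + Ccos z * Csin u - Csin z - Ccos z * u)%C
  with (Csin z * (Ccos u - RtoC 1) + Ccos z * (Csin u - u))%C by ring.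
eapply Rle_trans; [apply Cmod_triangle|]; rewrite !Cmod_mult.
apply Rle_trans with (eps / S * Cmod u * S).
- generalize (Cmod_ge_0 (Csin z)) (Cmod_ge_0 (Ccos z)) (Cmod_ge_0 u)
    (Rdiv_lt_0_compat _ _ Heps HS); unfold S at 3; intros.
  assert (0 <= eps / S * Cmod u) by nra.
  nra.
- right; field; lra.
Qed.

Lemma cosh_sqr x : cosh x ^ 2 = 1 + sinh x ^ 2.
Proof.
unfold sinh, cosh; assert (H : exp x * exp (- x) = 1)
  by (rewrite <- exp_plus, Rplus_opp_r; apply exp_0).
nra.
Qed.

Lemma Cmod_sqr (z : C) : Cmod z ^ 2 = fst z ^ 2 + snd z ^ 2.
Proof. apply Cmod2_alt. Qed.

(** Yields the zeros of the sine and both lower bounds for it: |sinh y| on horizontal lines, |sin x|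
    on vertical ones. *)
Lemma Cmod_Csin_sqr (z : C) : Cmod (Csin z) ^ 2 = sin (fst z) ^ 2 + sinh (snd z) ^ 2.
Proof.
rewrite Cmod_sqr; unfold Csin; simpl fst; simpl snd.
rewrite !Rpow_mult_distr, cosh_sqr.
assert (H := sin2_cos2 (fst z)); unfold Rsqr in H; nra.
Qed.

(** * The discretization error of the sinc series *)

Lemma Zsum_nil (a b : Z) u : (b < a)%Z -> Zsum a b u = RtoC 0.
Proof.
intros H; unfold Zsum; rewrite sum_n_m_zero; [reflexivity|lia].
Qed.

Lemma Zsum_last (a b : Z) u : (a <= b)%Z -> Zsum a b u = (Zsum a (b - 1) u + u b)%C.
Proof.
intros H; unfold Zsum.
replace (Z.to_nat (b - a + 1)) with (S (Z.to_nat (b - 1 - a + 1))) by lia.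
rewrite sum_n_Sm by lia.
replace (a + Z.of_nat (S (Z.to_nat (b - 1 - a + 1))) - 1)%Z with b by lia.
reflexivity.
Qed.

Lemma Zsum_ind (P : Z -> C -> Prop) (a : Z) u :
  P (a - 1)%Z (RtoC 0) ->
  (forall b s, (a <= b)%Z -> P (b - 1)%Z s -> P b (s + u b)%C) ->
  forall b, (a - 1 <= b)%Z -> P b (Zsum a b u).
Proof.
intros H0 HS b Hb.
replace b with (a - 1 + Z.of_nat (Z.to_nat (b - a + 1)))%Z by lia.
induction (Z.to_nat (b - a + 1)) as [|n IH].
- rewrite Zsum_nil by lia.
  now replace (a - 1 + Z.of_nat 0)%Z with (a - 1)%Z by lia.
- rewrite Zsum_last by lia; apply HS; [lia|].
  now replace (a - 1 + Z.of_nat (S n) - 1)%Z with (a - 1 + Z.of_nat n)%Z by lia.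
Qed.

Lemma Zsum_split (a b c : Z) u : (a - 1 <= b)%Z -> (b <= c)%Z ->
  Zsum a c u = (Zsum a b u + Zsum (b + 1) c u)%C.
Proof.
intros Hab Hbc; symmetry.
pattern c, (Zsum (b + 1) c u); apply Zsum_ind; [| |lia].
- replace (b + 1 - 1)%Z with b by lia; ring.
- intros k s Hk Hs; rewrite (Zsum_last a k) by lia; rewrite <- Hs; ring.
Qed.

Lemma Zsum_ext (a b : Z) u v : (forall k, (a <= k <= b)%Z -> u k = v k) ->
  Zsum a b u = Zsum a b v.
Proof.
intros H; apply sum_n_m_ext_loc; intros k Hk; apply H; lia.
Qed.

Lemma Zsum_mult_l (c : C) (a b : Z) u :
  Zsum a b (fun k => c * u k)%C = (c * Zsum a b u)%C.
Proof. exact (sum_n_m_mult_l (K := C_Ring) c _ _ _). Qed.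

Lemma Zsum_single (a b j : Z) u : (a <= j <= b)%Z ->
  (forall k, k <> j -> u k = RtoC 0) -> Zsum a b u = u j.
Proof.
intros Hj Hu.
assert (H0 : forall a b, (b < j \/ j < a)%Z -> Zsum a b u = RtoC 0).
{ intros a' b' H; rewrite (Zsum_ext a' b' u (fun k => RtoC 0 * u k)%C).
  - rewrite Zsum_mult_l; ring.
  - intros k Hk; rewrite Hu by lia; ring. }
rewrite (Zsum_split a j b), Zsum_last by lia.
rewrite !H0 by lia; ring.
Qed.

Lemma sin_IZR_PI k : sin (IZR k * PI) = 0.
Proof. apply sin_eq_0_1; now exists k. Qed.

Lemma cos_IZR_PI_sqr k : cos (IZR k * PI) * cos (IZR k * PI) = 1.
Proof.
generalize (sin2_cos2 (IZR k * PI)); unfold Rsqr; rewrite sin_IZR_PI; lra.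
Qed.

Lemma sinc_grid (k j : Z) h : 0 < h ->
  sinc k h (IZR j * h) = if Z.eq_dec k j then 1 else 0.
Proof.
intros Hh; unfold sinc.
destruct Z.eq_dec as [->|Hkj].
- destruct Req_EM_T; lra.
- destruct Req_EM_T as [E|E].
  + apply Rmult_eq_reg_r in E; [|lra]; apply eq_IZR in E; lia.
  + replace (PI * (IZR j * h / h - IZR k)) with (IZR (j - k) * PI)
      by (rewrite minus_IZR; field; lra).
    rewrite sin_IZR_PI; unfold Rdiv; ring.
Qed.

Lemma sinc_off_grid (k : Z) h x : 0 < h -> x <> IZR k * h ->
  sinc k h x = cos (IZR k * PI) * sin (PI / h * x) * h / (PI * (x - IZR k * h)).
Proof.
intros Hh Hx; unfold sinc; destruct Req_EM_T as [|_]; [easy|].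
replace (PI * (x / h - IZR k)) with (PI / h * x - IZR k * PI) at 1 by (field; lra).
rewrite sin_minus, sin_IZR_PI.
field; repeat split; try lra; apply PI_neq0.
Qed.

Lemma Csin_eq_0 (z : C) : Csin z = RtoC 0 -> snd z = 0 /\ exists k, fst z = IZR k * PI.
Proof.
intros H; assert (E := Cmod_Csin_sqr z).
rewrite H, Cmod_0 in E.
assert (H1 := pow2_ge_0 (sin (fst z))); assert (H2 := pow2_ge_0 (sinh (snd z))).
split.
- rewrite <- (arcsinh_sinh (snd z)).
  assert (E0 : sinh (snd z) = 0) by nra.
  rewrite E0; rewrite <- sinh_0 at 1; apply arcsinh_sinh.
- apply sin_eq_0_0; nra.
Qed.

Lemma is_derive_Csin_scal (c : R) (z : C) :
  @is_derive C_AbsRing C_NormedModule (fun z => Csin (RtoC c * z)%C) z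
    (RtoC c * Ccos (RtoC c * z))%C.
Proof.
apply is_derive_C_AbsRing_iff.
apply (is_derive_comp (K := C_AbsRing) (V := AbsRing_NormedModule C_AbsRing) Csin
  (fun z => RtoC c * z)%C z).
- apply is_derive_C_AbsRing_iff, is_derive_Csin.
- apply is_derive_C_AbsRing_iff, is_derive_C_iff; intros eps Heps.
  exists 1; split; [lra|]; intros w _.
  replace (RtoC c * w - RtoC c * z - RtoC c * (w - z))%C with (RtoC 0) by ring.
  rewrite Cmod_0; apply Rmult_le_pos; [lra|apply Cmod_ge_0].
Qed.

Section Sinc_kernel.

Variables (F : C -> C) (d h x : R).
Hypotheses (Hd : 0 < d) (Hh : 0 < h).
(** In this section [d] is the half-height of the contour, so the closed strip is included;
    [discretization_limit] applies the results with a smaller height than that of the strip of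
    analyticity. *)
Hypothesis HF : forall z, Rabs (snd z) <= d -> Cdiff F z.
Hypothesis Hx : forall k, x <> IZR k * h.

Let snh (z : C) : C := Csin (RtoC (PI / h) * z).
Let g (z : C) : C := (F z / ((z - RtoC x) * snh z))%C.
(** The residue of [g] at kh, where sin(pi z / h) has derivative (pi / h) cos(k pi). *)
Let r (k : Z) : C :=
  (F (RtoC (IZR k * h)) / (RtoC (IZR k * h) - RtoC x) / RtoC (PI / h * cos (IZR k * PI)))%C.

Lemma scaled_sin_zero z : snh z = RtoC 0 -> snd z = 0 /\ exists k, fst z = IZR k * h.
Proof.
intros H; apply Csin_eq_0 in H; destruct z as [u v]; simpl in *.
assert (HP := PI_RGT_0); assert (Hc : 0 < PI / h) by now apply Rdiv_lt_0_compat.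
destruct H as [H1 [k H2]]; split.
- apply Rmult_eq_reg_l with (PI / h); lra.
- exists k; apply Rmult_eq_reg_l with (PI / h); [|lra].
  replace (PI / h * (IZR k * h)) with (IZR k * PI) by (field; lra); lra.
Qed.

Lemma sinc_kernel_diff z : Rabs (snd z) <= d -> z <> RtoC x ->
  (snd z <> 0 \/ forall k, fst z <> IZR k * h) -> Cdiff g z.
Proof.
intros Hz Hzx Hzk.
apply (Cdiff_div F (fun z => (z - RtoC x) * snh z)%C); auto.
- apply Cdiff_mult; [apply Cdiff_minus; [apply Cdiff_id|apply Cdiff_const]|].
  eexists; apply is_derive_Csin_scal.
- apply Cmult_neq_0; [now apply Cminus_neq_0|].
  intros E; apply scaled_sin_zero in E; destruct E as [E1 [k E2]].
  destruct Hzk as [H|H]; [auto|now apply (H k)].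
Qed.

Lemma sinc_kernel_pole_grid k : simple_pole g (RtoC (IZR k * h)) (r k).
Proof.
assert (HP := PI_RGT_0).
assert (Hne : RtoC (IZR k * h) <> RtoC x)
  by (intros E; apply RtoC_inj in E; now apply (Hx k)).
assert (Hcos : cos (IZR k * PI) <> 0).
{ intros E; generalize (cos_IZR_PI_sqr k); rewrite E; lra. }
assert (Hs : simple_pole (fun z => (F z / (z - RtoC x)) / snh z)%C (RtoC (IZR k * h)) (r k)).
{ apply (simple_pole_div (fun z => F z / (z - RtoC x))%C).
  - apply Cdiff_cont, Cdiff_div.
    + apply HF; simpl; rewrite Rabs_R0; lra.
    + apply Cdiff_minus; [apply Cdiff_id|apply Cdiff_const].
    + now apply Cminus_neq_0.
  - replace (RtoC (PI / h * cos (IZR k * PI))) with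
      (RtoC (PI / h) * Ccos (RtoC (PI / h) * RtoC (IZR k * h)))%C.
    + apply is_derive_Csin_scal.
    + rewrite (RtoC_mult (PI / h) (cos _)); f_equal.
      rewrite <- RtoC_mult; unfold Ccos; simpl.
      replace (PI / h * (IZR k * h)) with (IZR k * PI) by (field; lra).
      rewrite cosh_0, sinh_0; unfold RtoC; f_equal; ring.
  - unfold snh; rewrite <- RtoC_mult; unfold Csin; simpl.
    replace (PI / h * (IZR k * h)) with (IZR k * PI) by (field; lra).
    rewrite cosh_0, sinh_0, sin_IZR_PI; unfold RtoC; f_equal; ring.
  - intros E; apply RtoC_inj in E; apply Rmult_integral in E.
    destruct E as [E|E]; auto.
    revert E; apply Rgt_not_eq; now apply Rdiv_lt_0_compat. }
intros eps Heps; destruct (Hs eps Heps) as [d1 [Hd1 H1]].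
set (d2 := Cmod (RtoC (IZR k * h) - RtoC x)).
assert (Hd2 : 0 < d2) by (apply Cmod_gt_0; now apply Cminus_neq_0).
(* The radii [d2] and [h] keep x and the other grid points away, so the kernel may be regrouped
   without dividing by 0. *)
exists (Rmin d1 (Rmin d2 h)); split; [repeat apply Rmin_pos; auto|].
intros z Hz Hzd.
assert (Hz1 := Rlt_le_trans _ _ _ Hzd (Rmin_l _ _)).
assert (Hz2 := Rlt_le_trans _ _ _ Hzd (Rmin_r _ _)).
assert (Hz3 := Rlt_le_trans _ _ _ Hz2 (Rmin_r _ _)).
assert (Hz4 := Rlt_le_trans _ _ _ Hz2 (Rmin_l _ _)).
replace (g z) with (F z / (z - RtoC x) / snh z)%C; [now apply H1|].
unfold g; field; split.
- intros E; apply scaled_sin_zero in E; destruct E as [E1 [j E2]].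
  apply Hz.
  assert (Ez : z = RtoC (IZR j * h)) by (destruct z; simpl in *; subst; reflexivity).
  rewrite Ez in Hz3; rewrite <- RtoC_minus, Cmod_R in Hz3.
  replace (IZR j * h - IZR k * h) with (IZR (j - k) * h) in Hz3 by (rewrite minus_IZR; ring).
  rewrite Rabs_mult, (Rabs_pos_eq h), <- abs_IZR in Hz3 by lra.
  assert (Hjk : IZR (Z.abs (j - k)) < 1) by nra.
  apply lt_IZR in Hjk; replace k with j by lia; exact Ez.
- intros E.
  assert (Ez : z = RtoC x)
    by (replace z with (z - RtoC x + RtoC x)%C by ring; rewrite E; ring).
  rewrite Ez in Hz4.
  assert (T : Cmod (RtoC x - RtoC (IZR k * h)) = d2)
    by (unfold d2; rewrite <- Cmod_opp; f_equal; ring).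
  lra.
Qed.

Lemma sin_off_grid : sin (PI / h * x) <> 0.
Proof.
intros E; apply sin_eq_0_0 in E; destruct E as [k E].
assert (HP := PI_RGT_0); assert (Hc : 0 < PI / h) by now apply Rdiv_lt_0_compat.
apply (Hx k), Rmult_eq_reg_l with (PI / h); [|lra].
rewrite E; field; lra.
Qed.

Lemma snh_real : snh (RtoC x) = RtoC (sin (PI / h * x)).
Proof.
unfold snh; rewrite <- RtoC_mult; unfold Csin; simpl.
rewrite cosh_0, sinh_0; unfold RtoC; f_equal; ring.
Qed.

(** Near x, (z - x) g(z) is F(z) / sin(pi z / h), which is continuous at x because x is off the
    grid. *)
Lemma sinc_kernel_pole_x : simple_pole g (RtoC x) (F (RtoC x) / RtoC (sin (PI / h * x)))%C.
Proof.
assert (Hsx : snh (RtoC x) <> RtoC 0).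
{ rewrite snh_real; intros E; apply RtoC_inj in E; now apply sin_off_grid. }
assert (Hdq : Cdiff (fun z => F z / snh z)%C (RtoC x)).
{ apply Cdiff_div; auto.
  - apply HF; simpl; rewrite Rabs_R0; lra.
  - eexists; apply is_derive_Csin_scal. }
assert (Hsc : Cdiff snh (RtoC x)) by (eexists; apply is_derive_Csin_scal).
rewrite <- snh_real.
intros eps Heps.
destruct (Cdiff_cont _ _ Hdq eps Heps) as [d1 [Hd1 H1]].
destruct (Cdiff_cont _ _ Hsc (Cmod (snh (RtoC x)))) as [d2 [Hd2 H2]].
{ now apply Cmod_gt_0. }
exists (Rmin d1 d2); split; [now apply Rmin_pos|]; intros z Hz Hzd.
specialize (H1 z (Rlt_le_trans _ _ _ Hzd (Rmin_l _ _))).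
specialize (H2 z (Rlt_le_trans _ _ _ Hzd (Rmin_r _ _))).
replace ((z - RtoC x) * g z)%C with (F z / snh z)%C; [lra|].
unfold g; field; split.
- intros E; rewrite E in H2.
  replace (RtoC 0 - snh (RtoC x))%C with (- snh (RtoC x))%C in H2 by ring.
  rewrite Cmod_opp in H2; lra.
- now apply Cminus_neq_0.
Qed.

Lemma ex_CInt_kernel_h a b y : a <= b -> y = d \/ y = - d -> ex_CInt (fun t => g (t, y)) a b.
Proof.
intros Hab Hy; apply ex_CInt_h; auto; intros t _.
apply Cdiff_cont, sinc_kernel_diff; simpl.
- destruct Hy as [-> | ->]; [rewrite Rabs_pos_eq|rewrite Rabs_left]; lra.
- intros E; injection E; lra.
- left; lra.
Qed.

Lemma rect_kernel_grid_pole k a b :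
  (IZR k - 1) * h < a < IZR k * h -> IZR k * h < b < (IZR k + 1) * h ->
  x < a \/ b < x -> rect g a b (- d) d = (RtoC (2 * PI) * Ci * r k)%C.
Proof.
intros Ha Hb Hxab.
apply (rect_simple_pole g (RtoC (IZR k * h))); simpl; try lra.
2: apply sinc_kernel_pole_grid.
intros z Hz1 Hz2 Hz; apply sinc_kernel_diff.
- apply Rabs_le; lra.
- intros E; rewrite E in Hz1; simpl in Hz1; lra.
- destruct (Req_dec (snd z) 0) as [E|E]; [right|now left].
  intros j Ej; apply Hz; destruct z as [u v]; simpl in *; subst v u.
  assert (H1 : IZR k - 1 < IZR j) by nra.
  assert (H2 : IZR j < IZR k + 1) by nra.
  rewrite <- minus_IZR in H1; rewrite <- plus_IZR in H2.
  apply lt_IZR in H1, H2; now replace j with k by lia.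
Qed.

(** Each vertical cut passes halfway between two grid points, so every piece holds a single pole;
    the sum grows from left to right. *)
Lemma rect_kernel_grid_poles i a : (IZR i - 1) * h < a < IZR i * h ->
  forall (n : nat) b, IZR (i + Z.of_nat n) * h < b < (IZR (i + Z.of_nat n) + 1) * h ->
  x < a \/ b < x ->
  rect g a b (- d) d = (RtoC (2 * PI) * Ci * Zsum i (i + Z.of_nat n) r)%C.
Proof.
intros Ha; induction n as [|n IH]; intros b Hb Hxab.
- replace (i + Z.of_nat 0)%Z with i in * by lia.
  rewrite Zsum_last, Zsum_nil by lia.
  rewrite (rect_kernel_grid_pole i) by auto; ring.
- assert (Hk : IZR (i + Z.of_nat (S n)) = IZR (i + Z.of_nat n) + 1)
    by (rewrite <- plus_IZR; f_equal; lia).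
  assert (Hin : IZR i <= IZR (i + Z.of_nat n)) by (apply IZR_le; lia).
  set (s := (IZR (i + Z.of_nat n) + / 2) * h).
  assert (Hs : IZR (i + Z.of_nat n) * h < s < (IZR (i + Z.of_nat n) + 1) * h)
    by (unfold s; nra).
  assert (Has : a <= s) by nra.
  rewrite Hk in Hb.
  rewrite (rect_split_x g a s b) by (apply ex_CInt_kernel_h; lra).
  rewrite (IH s) by (auto; lra).
  rewrite (rect_kernel_grid_pole (i + Z.of_nat (S n)) s b)
    by (try rewrite Hk; unfold s in *; nra).
  rewrite (Zsum_last i (i + Z.of_nat (S n))) by lia.
  replace (i + Z.of_nat (S n) - 1)%Z with (i + Z.of_nat n)%Z by lia.
  ring.
Qed.

Lemma rect_kernel (m : nat) (T : R) : Rabs x < INR m * h -> INR m * h < T < (INR m + 1) * h ->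
  (RtoC (sin (PI / h * x)) * rect g (- T) T (- d) d)%C =
  (RtoC (2 * PI) * Ci * (F (RtoC x) -
     Zsum (- Z.of_nat m) (Z.of_nat m) (fun k => F (RtoC (IZR k * h)) * RtoC (sinc k h x))))%C.
Proof.
intros Hxm HT; rewrite INR_IZR_INZ in Hxm, HT.
set (k0 := Zfloor (x / h)).
assert (Hfl : IZR k0 * h < x < (IZR k0 + 1) * h).
{ destruct (Zfloor_bound (x / h)) as [H1 H2]; fold k0 in H1, H2.
  apply Rle_div_r in H1; auto; apply Rlt_div_l in H2; auto.
  specialize (Hx k0); lra. }
apply Rabs_def2 in Hxm.
assert (Hk1 : (- Z.of_nat m <= k0)%Z).
{ assert (H : IZR (- Z.of_nat m) < IZR (k0 + 1)) by (rewrite opp_IZR, plus_IZR; nra).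
  apply lt_IZR in H; lia. }
assert (Hk2 : (k0 + 1 <= Z.of_nat m)%Z).
{ assert (H : IZR k0 < IZR (Z.of_nat m)) by nra.
  apply lt_IZR in H; lia. }
(* Cuts halfway between x and its two grid neighbours: the outer pieces hold grid poles only, the
   middle one only the pole at x. *)
set (s1 := (IZR k0 * h + x) / 2); set (s2 := (x + (IZR k0 + 1) * h) / 2).
assert (H1 : IZR (- Z.of_nat m) <= IZR k0) by now apply IZR_le.
assert (H2 : IZR (k0 + 1) <= IZR (Z.of_nat m)) by now apply IZR_le.
rewrite opp_IZR in H1; rewrite plus_IZR in H2.
assert (HTs1 : - T <= s1) by (unfold s1; nra).
assert (HTs2 : s2 <= T) by (unfold s2; nra).
rewrite (rect_split_x g (- T) s1 T) by (apply ex_CInt_kernel_h; unfold s1, s2 in *; lra).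
rewrite (rect_split_x g s1 s2 T) by (apply ex_CInt_kernel_h; unfold s1, s2 in *; lra).
assert (L : rect g (- T) s1 (- d) d = (RtoC (2 * PI) * Ci * Zsum (- Z.of_nat m) k0 r)%C).
{ replace k0 with (- Z.of_nat m + Z.of_nat (Z.to_nat (k0 + Z.of_nat m)))%Z at 1 by lia.
  apply rect_kernel_grid_poles.
  - rewrite opp_IZR; lra.
  - replace (- Z.of_nat m + Z.of_nat (Z.to_nat (k0 + Z.of_nat m)))%Z with k0 by lia.
    unfold s1; lra.
  - right; unfold s1; lra. }
assert (U : rect g s2 T (- d) d = (RtoC (2 * PI) * Ci * Zsum (k0 + 1) (Z.of_nat m) r)%C).
{ replace (Z.of_nat m) with (k0 + 1 + Z.of_nat (Z.to_nat (Z.of_nat m - k0 - 1)))%Z at 1 by lia.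
  apply rect_kernel_grid_poles.
  - rewrite plus_IZR; unfold s2; lra.
  - replace (k0 + 1 + Z.of_nat (Z.to_nat (Z.of_nat m - k0 - 1)))%Z with (Z.of_nat m) by lia.
    lra.
  - left; unfold s2; lra. }
assert (M : rect g s1 s2 (- d) d =
  (RtoC (2 * PI) * Ci * (F (RtoC x) / RtoC (sin (PI / h * x))))%C).
{ apply (rect_simple_pole g (RtoC x)); simpl; try (unfold s1, s2; lra).
  2: apply sinc_kernel_pole_x.
  intros z Hz1 Hz2 Hz; apply sinc_kernel_diff; auto.
  - apply Rabs_le; lra.
  - right; intros j Ej; rewrite Ej in Hz1; unfold s1, s2 in Hz1.
    assert (J1 : IZR k0 < IZR j) by nra.
    assert (J2 : IZR j < IZR (k0 + 1)) by (rewrite plus_IZR; nra).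
    apply lt_IZR in J1, J2; lia. }
rewrite L, M, U.
assert (Hsin : RtoC (sin (PI / h * x)) <> RtoC 0)
  by (intros E; apply RtoC_inj in E; now apply sin_off_grid).
rewrite (Zsum_ext _ _ (fun k => F (RtoC (IZR k * h)) * RtoC (sinc k h x))%C
  (fun k => - RtoC (sin (PI / h * x)) * r k)%C).
{ rewrite Zsum_mult_l, (Zsum_split (- Z.of_nat m) k0 (Z.of_nat m)) by lia.
  field; auto. }
intros k _; unfold r.
assert (HP := PI_RGT_0).
rewrite sinc_off_grid by auto.
assert (Hxk : IZR k * h - x <> 0) by (intros E; apply (Hx k); lra).
(* The sign cos(k pi) is its own inverse: the residue carries it in the denominator, the sinc
   function in the numerator. *)
assert (Hcc : cos (IZR k * PI) = / cos (IZR k * PI)).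
{ apply Rmult_eq_reg_r with (cos (IZR k * PI)).
  - rewrite cos_IZR_PI_sqr, Rinv_l; auto.
    intros E; generalize (cos_IZR_PI_sqr k); rewrite E; lra.
  - intros E; generalize (cos_IZR_PI_sqr k); rewrite E; lra. }
assert (Hc0 : cos (IZR k * PI) <> 0)
  by (intros E; generalize (cos_IZR_PI_sqr k); rewrite E; lra).
replace (cos (IZR k * PI) * sin (PI / h * x) * h / (PI * (x - IZR k * h)))
  with (- (sin (PI / h * x) * / (IZR k * h - x) * / (PI / h * cos (IZR k * PI)))).
2:{ transitivity (/ cos (IZR k * PI) * sin (PI / h * x) * h / (PI * (x - IZR k * h)));
      [|now rewrite <- Hcc].
    field; repeat split; lra. }
assert (Hpc : PI / h * cos (IZR k * PI) <> 0).
{ apply Rmult_integral_contrapositive; split; auto.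
  apply Rgt_not_eq, Rdiv_lt_0_compat; auto. }
rewrite RtoC_opp, !RtoC_mult, (RtoC_inv (_ - _)), (RtoC_inv (PI / h * _)) by auto.
rewrite RtoC_minus, !RtoC_mult.
unfold Cdiv; ring.
Qed.

(** Besides the sine, |z - x| >= |Im z| = d on these sides; hence the factor 1/d of the constant. *)
Lemma Cmod_kernel_h_le (G : R -> R) y a b l : a <= b -> y = d \/ y = - d ->
  (forall t, Cmod (F (t, y)) <= G t) -> is_RInt G a b l ->
  Cmod (CInt (fun t => g (t, y)) a b) <= l / (d * sinh (PI * d / h)).
Proof.
intros Hab Hy HG Hl.
assert (HP := PI_RGT_0).
assert (Hsh : 0 < sinh (PI * d / h)).
{ rewrite <- sinh_0; apply sinh_lt, Rdiv_lt_0_compat; auto; nra. }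
assert (Hp : 0 < d * sinh (PI * d / h)) by nra.
apply Cmod_CInt_le with (fun t => / (d * sinh (PI * d / h)) * G t); auto.
- now apply ex_CInt_kernel_h.
- intros t _.
  assert (Hy2 : y ^ 2 = d ^ 2) by (destruct Hy as [-> | ->]; ring).
  assert (E1 : d <= Cmod ((t, y) - RtoC x)).
  { eapply Rle_trans; [|apply abs_snd_le_Cmod]; simpl.
    replace (y + - 0) with y by ring.
    destruct Hy as [-> | ->]; [rewrite Rabs_pos_eq|rewrite Rabs_left]; lra. }
  assert (E2 : sinh (PI * d / h) <= Cmod (snh (t, y))).
  { apply Rsqr_incr_0_var; [|apply Cmod_ge_0].
    rewrite !Rsqr_pow2; unfold snh; rewrite Cmod_Csin_sqr; simpl fst; simpl snd.
    replace (PI / h * y + 0 * t) with (PI / h * y) by ring.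
    replace (sinh (PI / h * y) ^ 2) with (sinh (PI * d / h) ^ 2).
    - generalize (pow2_ge_0 (sin (PI / h * t - 0 * y))); lra.
    - replace (PI * d / h) with (PI / h * d) by (field; lra).
      destruct Hy as [-> | ->]; auto.
      replace (PI / h * - d) with (- (PI / h * d)) by ring.
      unfold sinh; rewrite Ropp_involutive; field. }
  assert (E3 : d * sinh (PI * d / h) <= Cmod (((t, y) - RtoC x) * snh (t, y)))
    by (rewrite Cmod_mult; apply Rmult_le_compat; lra).
  unfold g; rewrite Cmod_div by (apply Cmod_gt_0; lra).
  rewrite Rmult_comm; unfold Rdiv; apply Rmult_le_compat; auto.
  + apply Cmod_ge_0.
  + left; apply Rinv_0_lt_compat; lra.
  + apply Rinv_le_contravar; lra.
- replace (l / (d * sinh (PI * d / h))) with (scal (/ (d * sinh (PI * d / h))) l)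
    by (unfold scal; simpl; unfold mult; simpl; field; lra).
  now apply (is_RInt_scal (V := R_NormedModule) G).
Qed.

Lemma Cmod_kernel_v_le (m : nat) (T u B : R) :
  T = (INR m + / 2) * h -> u = T \/ u = - T -> Rabs x < T ->
  (forall z, Rabs (snd z) <= d -> Cmod (F z) <= B) ->
  Cmod (CInt (fun t => g (u, t)) (- d) d) <= 2 * d * (B / (T - Rabs x)).
Proof.
intros HT Hu HxT HB.
(* The abscissa lies halfway between grid points, so the complex sine has modulus at least 1 on the
   whole side. *)
assert (Hsin : sin (PI / h * u) ^ 2 = 1).
{ assert (HPT : PI / h * T = IZR (Z.of_nat m) * PI + PI / 2)
    by (rewrite <- INR_IZR_INZ, HT; field; lra).
  assert (E : sin (PI / h * T) = cos (IZR (Z.of_nat m) * PI))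
    by (rewrite HPT, sin_plus, cos_PI2, sin_PI2; ring).
  assert (E2 := cos_IZR_PI_sqr (Z.of_nat m)).
  destruct Hu as [-> | ->].
  - rewrite E; lra.
  - replace (PI / h * - T) with (- (PI / h * T)) by ring.
    rewrite sin_neg, E; lra. }
assert (Hux : T - Rabs x <= Rabs (u - x)).
{ destruct (Rabs_def2 _ _ HxT) as [H1 H2].
  destruct Hu as [-> | ->].
  - rewrite (Rabs_pos_eq (T - x)) by lra; generalize (Rle_abs x); lra.
  - rewrite (Rabs_left (- T - x)) by lra; generalize (Rle_abs (- x)); rewrite Rabs_Ropp; lra. }
replace (2 * d) with (d - - d) by ring.
apply Cmod_CInt_le_const; [lra| |].
- apply ex_CInt_v; [lra|]; intros y Hy.
  apply Cdiff_cont, sinc_kernel_diff; simpl.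
  + now apply Rabs_le.
  + intros E; injection E; intros _ E'; rewrite E', Rminus_diag, Rabs_R0 in Hux; lra.
  + right; intros k E; rewrite E in Hsin.
    replace (PI / h * (IZR k * h)) with (IZR k * PI) in Hsin by (field; lra).
    rewrite sin_IZR_PI in Hsin; lra.
- intros t Ht.
  assert (E1 : T - Rabs x <= Cmod ((u, t) - RtoC x))
    by (eapply Rle_trans; [apply Hux|apply (abs_fst_le_Cmod ((u, t) - RtoC x))]).
  assert (E2 : 1 <= Cmod (snh (u, t))).
  { apply Rsqr_incr_0_var; [|apply Cmod_ge_0].
    rewrite !Rsqr_pow2; unfold snh; rewrite Cmod_Csin_sqr; simpl fst; simpl snd.
    replace (PI / h * u - 0 * t) with (PI / h * u) by ring.
    rewrite Hsin; generalize (pow2_ge_0 (sinh (PI / h * t + 0 * u))); lra. }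
  assert (E3 : T - Rabs x <= Cmod (((u, t) - RtoC x) * snh (u, t)))
    by (rewrite Cmod_mult; nra).
  unfold g; rewrite Cmod_div by (apply Cmod_gt_0; lra).
  unfold Rdiv; apply Rmult_le_compat.
  + apply Cmod_ge_0.
  + left; apply Rinv_0_lt_compat; lra.
  + apply HB; simpl; now apply Rabs_le.
  + apply Rinv_le_contravar; lra.
Qed.

Lemma sinc_discretization_off_grid (G : R -> R) (m : nat) (T B l : R) :
  T = (INR m + / 2) * h -> Rabs x < INR m * h ->
  (forall z, Rabs (snd z) <= d -> Cmod (F z) <= B) ->
  (forall t, Cmod (F (t, d)) <= G t) -> (forall t, Cmod (F (t, - d)) <= G t) ->
  is_RInt G (- T) T l ->
  Cmod (F (RtoC x) - Zsum (- Z.of_nat m) (Z.of_nat m)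
    (fun k => F (RtoC (IZR k * h)) * RtoC (sinc k h x))%C) <=
  l / (PI * d * sinh (PI * d / h)) + 2 * d * B / (PI * (T - Rabs x)).
Proof.
intros HT Hxm HB HG1 HG2 Hl.
assert (HP := PI_RGT_0).
assert (Hsh : 0 < sinh (PI * d / h)).
{ rewrite <- sinh_0; apply sinh_lt, Rdiv_lt_0_compat; auto; nra. }
assert (HxT : Rabs x < T) by (rewrite HT; lra).
assert (E := rect_kernel m T Hxm ltac:(rewrite HT; lra)).
apply (f_equal Cmod) in E; rewrite !Cmod_mult, Cmod_Ci, !Cmod_R in E.
rewrite (Rabs_pos_eq (2 * PI)), Rmult_1_r in E by lra.
match type of E with _ = _ * ?A => set (err := A) in * end.
assert (J : Cmod (rect g (- T) T (- d) d) <=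
  2 * (l / (d * sinh (PI * d / h))) + 2 * (2 * d * (B / (T - Rabs x)))).
{ unfold rect; unfold Cminus.
  eapply Rle_trans; [apply Cmod_triangle|].
  rewrite Cmod_mult, Cmod_Ci, Rmult_1_l.
  eapply Rle_trans; [apply Rplus_le_compat; apply Cmod_triangle|].
  rewrite !Cmod_opp.
  assert (0 <= Rabs x) by apply Rabs_pos.
  generalize (Cmod_kernel_h_le G d (- T) T l ltac:(lra) (or_introl eq_refl) HG1 Hl)
    (Cmod_kernel_h_le G (- d) (- T) T l ltac:(lra) (or_intror eq_refl) HG2 Hl)
    (Cmod_kernel_v_le m T T B HT (or_introl eq_refl) HxT HB)
    (Cmod_kernel_v_le m T (- T) B HT (or_intror eq_refl) HxT HB).
  lra. }
assert (Hs : Rabs (sin (PI / h * x)) <= 1) by (apply Rabs_le, SIN_bound).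
assert (K : 2 * PI * err <= Cmod (rect g (- T) T (- d) d)).
{ rewrite <- E; generalize (Cmod_ge_0 (rect g (- T) T (- d) d)); nra. }
apply Rmult_le_reg_l with (2 * PI); [lra|].
eapply Rle_trans; [apply K|]; eapply Rle_trans; [apply J|].
right; field; repeat split; lra.
Qed.

End Sinc_kernel.

(* On the grid the residue argument is void, the pole at x being double, but the
   interpolation is exact there. *)
Lemma sinc_discretization (F : C -> C) (d h x : R) (G : R -> R) (m : nat) (T B l : R) :
  0 < d -> 0 < h ->
  (forall z, Rabs (snd z) <= d -> Cdiff F z) ->
  T = (INR m + / 2) * h -> Rabs x < INR m * h ->
  (forall z, Rabs (snd z) <= d -> Cmod (F z) <= B) ->
  (forall t, Cmod (F (t, d)) <= G t) -> (forall t, Cmod (F (t, - d)) <= G t) ->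
  is_RInt G (- T) T l -> 0 <= l ->
  Cmod (F (RtoC x) - Zsum (- Z.of_nat m) (Z.of_nat m)
    (fun k => F (RtoC (IZR k * h)) * RtoC (sinc k h x))%C) <=
  l / (PI * d * sinh (PI * d / h)) + 2 * d * B / (PI * (T - Rabs x)).
Proof.
intros Hd Hh HF HT Hxm HB HG1 HG2 Hl Hl0.
destruct (Classical_Prop.classic (exists j, x = IZR j * h)) as [[j Hj]|Hx].
2:{ apply (sinc_discretization_off_grid F d h x Hd Hh HF) with (G := G); auto.
    intros k E; apply Hx; now exists k. }
rewrite (Zsum_single _ _ j), Hj.
- rewrite sinc_grid by auto; destruct Z.eq_dec; [|easy].
  replace (F (RtoC (IZR j * h)) - F (RtoC (IZR j * h)) * RtoC 1)%C with (RtoC 0) by ring.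
  rewrite Cmod_0, <- Hj.
  assert (HP := PI_RGT_0).
  assert (Hsh : 0 < sinh (PI * d / h)).
  { rewrite <- sinh_0; apply sinh_lt, Rdiv_lt_0_compat; auto; nra. }
  assert (HB0 : 0 <= B).
  { eapply Rle_trans; [apply Cmod_ge_0|apply (HB (RtoC 0))]; simpl; rewrite Rabs_R0; lra. }
  apply Rplus_le_le_0_compat; apply Rdiv_le_0_compat; auto; [|nra|].
  + apply Rmult_lt_0_compat; nra.
  + apply Rmult_lt_0_compat; auto; rewrite HT; lra.
- rewrite INR_IZR_INZ, Hj in Hxm.
  rewrite Rabs_mult, (Rabs_pos_eq h), <- abs_IZR in Hxm by lra.
  apply Rmult_lt_reg_r, lt_IZR in Hxm; auto; lia.
- intros k Hk; rewrite Hj, sinc_grid by auto; destruct Z.eq_dec; [easy|ring].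
Qed.

(** * Double exponential decay *)

Lemma cosh_ge_1 x : 1 <= cosh x.
Proof.
assert (H := cosh_sqr x); assert (H2 := pow2_ge_0 (sinh x)).
assert (0 < cosh x) by (unfold cosh; generalize (exp_pos x) (exp_pos (- x)); lra).
nra.
Qed.

Lemma sinh_opp x : sinh (- x) = - sinh x.
Proof. unfold sinh; rewrite Ropp_involutive; field. Qed.

Lemma sinh_ge_id x : 0 <= x -> x <= sinh x.
Proof.
intros [Hx| <-]; [|rewrite sinh_0; lra].
destruct (MVT_cor2 sinh cosh 0 x Hx) as [c [Hc _]].
{ intros; apply derivable_pt_lim_sinh. }
rewrite sinh_0 in Hc; generalize (cosh_ge_1 c); nra.
Qed.

Lemma sinh_nonneg x : 0 <= x -> 0 <= sinh x.
Proof. intros H; generalize (sinh_ge_id x H); lra. Qed.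

Lemma sinh_le x y : x <= y -> sinh x <= sinh y.
Proof. intros [H| <-]; [left; now apply sinh_lt|lra]. Qed.

Lemma cosh_le x y : 0 <= x -> x <= y -> cosh x <= cosh y.
Proof.
intros Hx Hxy; generalize (sinh_nonneg x Hx) (sinh_le x y Hxy) (cosh_sqr x) (cosh_sqr y)
  (cosh_ge_1 x) (cosh_ge_1 y); nra.
Qed.

(** Half-argument formula cosh u = 1 + 2 sinh^2(u/2), together with |sinh t| >= |t|. *)
Lemma cosh_ge_quadratic u : 1 + u ^ 2 / 2 <= cosh u.
Proof.
assert (H : (u / 2) ^ 2 <= sinh (u / 2) ^ 2).
{ destruct (Rle_dec 0 u) as [Hu|Hu].
  - generalize (sinh_ge_id (u / 2)); nra.
  - generalize (sinh_ge_id (- (u / 2))); rewrite sinh_opp; nra. }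
replace u with (u / 2 + u / 2) at 2 by field.
rewrite cosh_plus; generalize (cosh_sqr (u / 2)); nra.
Qed.

Lemma Rabs_sin_le_abs t : Rabs (sin t) <= Rabs t.
Proof.
destruct (Rtotal_order t 0) as [Ht|[->|Ht]].
- destruct (MVT_cor2 sin cos t 0 Ht) as [c [Hc _]].
  { intros; apply derivable_pt_lim_sin. }
  rewrite sin_0 in Hc; generalize (COS_bound c); intros.
  rewrite (Rabs_left t) by lra; apply Rabs_le; nra.
- rewrite sin_0; lra.
- destruct (MVT_cor2 sin cos 0 t Ht) as [c [Hc _]].
  { intros; apply derivable_pt_lim_sin. }
  rewrite sin_0 in Hc; generalize (COS_bound c); intros.
  rewrite (Rabs_pos_eq t) by lra; apply Rabs_le; nra.
Qed.

(** Expand sin(a + (v - a)) and use |cos| <= 1 and |sin t| <= |t|. Concavity of the sine would not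
    reach the large values of v that occur. *)
Lemma Rabs_sin_le_tangent a v : 0 <= a <= PI / 2 -> a <= v ->
  Rabs (sin v) <= sin a + cos a * (v - a).
Proof.
intros Ha Hv.
assert (HP := PI_RGT_0).
assert (Hs : 0 <= sin a) by (apply sin_ge_0; lra).
assert (Hc : 0 <= cos a) by (apply cos_ge_0; lra).
replace (sin v) with (sin a * cos (v - a) + cos a * sin (v - a))
  by (rewrite <- sin_plus; f_equal; ring).
eapply Rle_trans; [apply Rabs_triang|]; rewrite !Rabs_mult.
rewrite (Rabs_pos_eq (sin a)), (Rabs_pos_eq (cos a)) by auto.
assert (H1 : Rabs (cos (v - a)) <= 1) by (apply Rabs_le, COS_bound).
assert (H2 := Rabs_sin_le_abs (v - a)); rewrite (Rabs_pos_eq (v - a)) in H2 by lra.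
nra.
Qed.

(** Both sides vanish at pi/2. Up to pi/3, tan a >= a and pi^2/4 - a^2 >= 1 suffice; beyond, the
    factor pi/2 - a must be kept, and cos a <= pi/2 - a with sin a >= 4/5 does it. *)
Lemma tan_quadratic_bound a : 0 <= a <= PI / 2 ->
  a * cos a <= (PI ^ 2 / 4 - a ^ 2) * sin a.
Proof.
intros Ha.
assert (HP := PI_RGT_0); assert (HP2 := PI2_3_2).
assert (Hs : 0 <= sin a) by (apply sin_ge_0; lra).
destruct (Rle_dec a (PI / 3)) as [H3|H3].
- assert (Ht : a * cos a <= sin a).
  { destruct (proj1 Ha) as [Ha0| <-]; [|rewrite sin_0; lra].
    destruct (MVT_cor2 sin cos 0 a Ha0) as [c [Hc Hc2]].
    { intros; apply derivable_pt_lim_sin. }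
    rewrite sin_0 in Hc.
    assert (cos a <= cos c) by (apply cos_decr_1; lra).
    nra. }
  assert (H9 : a ^ 2 <= (PI / 3) ^ 2) by (apply pow_incr; lra).
  assert (H1 : 1 <= PI ^ 2 / 4 - a ^ 2) by nra.
  nra.
- assert (Hc : cos a <= PI / 2 - a).
  { rewrite <- sin_shift; generalize (Rabs_sin_le_abs (PI / 2 - a)) (Rle_abs (sin (PI / 2 - a))).
    rewrite (Rabs_pos_eq (PI / 2 - a)); lra. }
  assert (Hs2 : 4 / 5 <= sin a).
  { apply Rle_trans with (sin (PI / 3)).
    - rewrite sin_PI3.
      assert (H := sqrt_sqrt 3 ltac:(lra)); generalize (sqrt_pos 3); nra.
    - apply sin_incr_1; lra. }
  apply Rle_trans with (a * (PI / 2 - a)); [nra|].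
  replace (PI ^ 2 / 4 - a ^ 2) with ((PI / 2 - a) * (PI / 2 + a)) by field.
  assert (Ha2 : a <= (PI / 2 + a) * sin a) by nra.
  rewrite Rmult_assoc, Rmult_comm; apply Rmult_le_compat_l; lra.
Qed.

Lemma Rabs_sin_le_cosh x y : Rabs y <= PI / 2 ->
  Rabs (sin (PI / 2 * (cosh x * sin y))) <=
  cosh (PI / 2 * (sinh x * cos y)) * sin (PI / 2 * Rabs (sin y)).
Proof.
(* With a = (pi/2)|sin y|, the two arguments are v = a cosh x and
   u^2 = (pi^2/4 - a^2) sinh^2 x; then |sin v| <= sin a + cos a (v - a) is
   compared with (1 + u^2/2) sin a, using sinh^2 x >= 2 (cosh x - 1). *)
intros Hy; assert (HP := PI_RGT_0).
set (s := Rabs (sin y)).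
assert (Hs0 : 0 <= s) by apply Rabs_pos.
assert (Hs1 : s <= 1) by (apply Rabs_le, SIN_bound).
assert (Hs2 : s ^ 2 + cos y ^ 2 = 1).
{ unfold s; rewrite pow2_abs; generalize (sin2_cos2 y); rewrite !Rsqr_pow2; auto. }
set (a := PI / 2 * s).
assert (Ha : 0 <= a <= PI / 2) by (unfold a; nra).
assert (Hch := cosh_ge_1 x).
assert (E : Rabs (sin (PI / 2 * (cosh x * sin y))) = Rabs (sin (a * cosh x))).
{ unfold a, s, Rabs at 3; destruct Rcase_abs as [H|H].
  - replace (PI / 2 * - sin y * cosh x) with (- (PI / 2 * (cosh x * sin y))) by ring.
    now rewrite sin_neg, Rabs_Ropp.
  - f_equal; f_equal; ring. }
rewrite E.
eapply Rle_trans; [apply (Rabs_sin_le_tangent a); [auto|nra]|].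
assert (Hsa : 0 <= sin a) by (apply sin_ge_0; lra).
set (u := PI / 2 * (sinh x * cos y)).
assert (Hu : (PI ^ 2 / 4 - a ^ 2) * (cosh x - 1) <= u ^ 2 / 2).
{ replace (u ^ 2) with ((PI ^ 2 / 4) * (cos y ^ 2) * (cosh x ^ 2 - 1))
    by (rewrite cosh_sqr; unfold u; field).
  replace (PI ^ 2 / 4 - a ^ 2) with ((PI ^ 2 / 4) * cos y ^ 2)
    by (unfold a; replace (cos y ^ 2) with (1 - s ^ 2) by lra; field).
  assert (H : 0 <= PI ^ 2 / 4 * cos y ^ 2)
    by (apply Rmult_le_pos; [generalize (pow2_ge_0 PI); lra|apply pow2_ge_0]).
  assert (2 * (cosh x - 1) <= cosh x ^ 2 - 1) by nra.
  nra. }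
assert (Hq := cosh_ge_quadratic u).
assert (Ht := tan_quadratic_bound a Ha).
apply Rle_trans with ((1 + u ^ 2 / 2) * sin a); [|nra].
apply Rle_trans with ((1 + (PI ^ 2 / 4 - a ^ 2) * (cosh x - 1)) * sin a); [|nra].
replace (cos a * (a * cosh x - a)) with (a * cos a * (cosh x - 1)) by ring.
nra.
Qed.

Lemma Cpsi_Cexp x y : Cpsi (x, y) =
  Cexp (PI / 2 * (sinh x * cos y), PI / 2 * (cosh x * sin y)).
Proof.
unfold Cpsi; f_equal; unfold Csinh, Cexp, sinh, cosh; simpl.
rewrite cos_neg, sin_neg.
unfold Cdiv, Cminus, Cplus, Copp, Cmult, Cinv, RtoC; simpl; f_equal; field.
Qed.

Lemma Cmod_Cexp w : Cmod (Cexp w) = exp (fst w).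
Proof.
assert (H := exp_pos (fst w)).
apply Rsqr_inj; [apply Cmod_ge_0|lra|].
rewrite !Rsqr_pow2, Cmod_sqr; unfold Cexp, Re, Im; simpl fst; simpl snd.
generalize (sin2_cos2 (snd w)); unfold Rsqr; nra.
Qed.

(** This is |1 + e^(2w)|^2 = |2 e^w cosh w|^2. The negative term - sin^2 v is what
    [Rabs_sin_le_cosh] has to control. *)
Lemma Cmod_1_plus_Cexp_sqr u v :
  Cmod (RtoC 1 + Cexp (u, v) * Cexp (u, v)) ^ 2 =
  (2 * exp u) ^ 2 * (cosh u ^ 2 - sin v ^ 2).
Proof.
rewrite Cmod_sqr; unfold Cexp, Re, Im, RtoC, Cplus, Cmult; simpl fst; simpl snd.
unfold cosh; rewrite exp_Ropp.
assert (H := exp_pos u); assert (E : cos v ^ 2 = 1 - sin v ^ 2)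
  by (generalize (sin2_cos2 v); unfold Rsqr; lra).
set (s := sin v) in *; set (c := cos v) in *; set (q := exp u) in *.
replace ((1 + (q * c * (q * c) - q * s * (q * s))) ^ 2 + (0 + (q * c * (q * s) + q * s * (q * c))) ^ 2)
  with ((1 + q ^ 2 * (c ^ 2 - s ^ 2)) ^ 2 + 4 * q ^ 4 * c ^ 2 * s ^ 2) by ring.
rewrite E; field; lra.
Qed.

Lemma Cmod_1_plus_Cpsi_sqr_ge x y : Rabs y <= PI / 2 ->
  let u := PI / 2 * (sinh x * cos y) in
  2 * exp u * cosh u * cos (PI / 2 * Rabs (sin y)) <=
  Cmod (RtoC 1 + Cpsi (x, y) * Cpsi (x, y)).
Proof.
intros Hy u; assert (HP := PI_RGT_0).
apply Rsqr_incr_0_var; [|apply Cmod_ge_0].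
rewrite !Rsqr_pow2, Cpsi_Cexp, Cmod_1_plus_Cexp_sqr; fold u.
assert (H := Rabs_sin_le_cosh x y Hy); fold u in H.
set (v := PI / 2 * (cosh x * sin y)) in *.
set (a := PI / 2 * Rabs (sin y)) in *.
assert (H2 : sin v ^ 2 <= (cosh u * sin a) ^ 2).
{ rewrite <- (pow2_abs (sin v)); apply pow_incr; split; [apply Rabs_pos|auto]. }
assert (E := sin2_cos2 a); rewrite !Rsqr_pow2 in E.
replace ((2 * exp u * cosh u * cos a) ^ 2) with ((2 * exp u) ^ 2 * (cosh u ^ 2 * cos a ^ 2)) by ring.
apply Rmult_le_compat_l; [apply pow2_ge_0|].
replace (cos a ^ 2) with (1 - sin a ^ 2) by lra.
rewrite Rpow_mult_distr in H2; lra.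
Qed.

(** [r] is any exponent below beta u for u >= 0 and below alpha |u| for u <= 0; [q] is a lower bound
    of the cosine. The strip estimate takes mu for both exponents and q = cos((pi/2) sin d); the
    real line takes q = 1 and keeps alpha and beta apart. *)
Lemma normE2_le_exp alpha beta x y q : 0 < alpha -> 0 < beta ->
  Rabs y <= PI / 2 -> 0 < q <= cos (PI / 2 * Rabs (sin y)) ->
  let u := PI / 2 * (sinh x * cos y) in
  forall r, (0 <= u -> r <= beta * u) -> (u <= 0 -> r <= - (alpha * u)) ->
  normE2 alpha beta (Cpsi (x, y)) <= exp (- r) / Rpower q ((alpha + beta) / 2).
Proof.
intros Ha Hb Hy Hq u r Hr1 Hr2.
set (s := (alpha + beta) / 2).
assert (Hs : 0 < s) by (unfold s; lra).
assert (HB := Cmod_1_plus_Cpsi_sqr_ge x y Hy); cbv zeta in HB; fold u in HB.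
unfold normE2; fold s.
replace (Cmod (Cpsi (x, y))) with (exp u) by (rewrite Cpsi_Cexp, Cmod_Cexp; reflexivity).
assert (Hlow : exp (u + Rabs u) * q <= Cmod (RtoC 1 + Cpsi (x, y) * Cpsi (x, y))).
{ eapply Rle_trans; [|apply HB].
  assert (Hch : exp (Rabs u) <= 2 * cosh u).
  { unfold cosh, Rabs; destruct Rcase_abs; generalize (exp_pos u) (exp_pos (- u)); lra. }
  rewrite exp_plus.
  assert (0 < exp u) by apply exp_pos; assert (0 < exp (Rabs u)) by apply exp_pos.
  replace (2 * exp u * cosh u * cos (PI / 2 * Rabs (sin y)))
    with (exp u * (2 * cosh u) * cos (PI / 2 * Rabs (sin y))) by ring.
  apply Rmult_le_compat; try lra; nra. }
assert (Hlow0 : 0 < exp (u + Rabs u) * q) by (generalize (exp_pos (u + Rabs u)); nra).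
assert (Hpow : exp (s * (u + Rabs u)) * Rpower q s <=
  Rpower (Cmod (RtoC 1 + Cpsi (x, y) * Cpsi (x, y))) s).
{ replace (exp (s * (u + Rabs u))) with (Rpower (exp (u + Rabs u)) s)
    by (unfold Rpower; now rewrite ln_exp).
  rewrite Rpower_mult_distr by (apply exp_pos || lra).
  apply Rle_Rpower_l; lra. }
assert (HRq : 0 < Rpower q s) by apply exp_pos.
assert (Hexp := exp_pos (s * (u + Rabs u))).
apply Rle_trans with (exp (alpha * u) / (exp (s * (u + Rabs u)) * Rpower q s)).
- replace (Rpower (exp u) alpha) with (exp (alpha * u))
    by (unfold Rpower; now rewrite ln_exp).
  apply Rmult_le_compat_l; [left; apply exp_pos|].
  apply Rinv_le_contravar; nra.
- replace (exp (alpha * u) / (exp (s * (u + Rabs u)) * Rpower q s))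
    with (exp (alpha * u - s * (u + Rabs u)) / Rpower q s).
  2:{ unfold Rminus; rewrite exp_plus, exp_Ropp; field; lra. }
  apply Rmult_le_compat_r; [left; now apply Rinv_0_lt_compat|].
  (* With s = (alpha + beta) / 2 the left side is - beta u for u >= 0 and alpha u for u < 0. *)
  assert (Hle : alpha * u - s * (u + Rabs u) <= - r).
  { unfold s, Rabs; destruct Rcase_abs; [specialize (Hr2 ltac:(lra))|specialize (Hr1 ltac:(lra))]; lra. }
  destruct Hle as [Hlt| ->]; [left; now apply exp_increasing|lra].
Qed.

(** * The majorant: its integral and the tails of its series *)

Lemma is_RInt_cosh_exp_sinh kappa a b : kappa <> 0 ->
  is_RInt (fun t => cosh t * exp (- (kappa * sinh t))) a b
    ((exp (- (kappa * sinh a)) - exp (- (kappa * sinh b))) / kappa).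
Proof.
intros Hk.
replace ((exp (- (kappa * sinh a)) - exp (- (kappa * sinh b))) / kappa)
  with (minus (- exp (- (kappa * sinh b)) / kappa) (- exp (- (kappa * sinh a)) / kappa))
  by (unfold minus, plus, opp; simpl; field; auto).
apply (is_RInt_derive (fun t => - exp (- (kappa * sinh t)) / kappa)).
- intros t _.
  apply (is_derive_comp (fun y => - exp (- (kappa * y)) / kappa) sinh); [|apply is_derive_sinh].
  auto_derive; auto; field; auto.
- intros t _; apply (ex_derive_continuous (fun t => cosh t * exp (- (kappa * sinh t)))).
  unfold sinh, cosh; auto_derive; auto.
Qed.

Lemma is_RInt_cosh_exp_abs_sinh kappa T : 0 < kappa -> 0 <= T ->
  is_RInt (fun t => cosh t * exp (- (kappa * Rabs (sinh t)))) (- T) T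
    (2 * (1 - exp (- (kappa * sinh T))) / kappa).
Proof.
intros Hk HT.
replace (2 * (1 - exp (- (kappa * sinh T))) / kappa) with
  (plus ((exp (- (- kappa * sinh (- T))) - exp (- (- kappa * sinh 0))) / - kappa)
    ((exp (- (kappa * sinh 0)) - exp (- (kappa * sinh T))) / kappa)).
2:{ rewrite sinh_opp, sinh_0, !Rmult_0_r, !Ropp_0, exp_0.
    replace (- (- kappa * - sinh T)) with (- (kappa * sinh T)) by ring.
    unfold plus; simpl; field; lra. }
apply (is_RInt_Chasles (V := R_NormedModule) _ _ 0).
(* On the negative half-line |sinh t| = - sinh t, hence the antiderivative with [- kappa]. *)
- eapply (is_RInt_ext (V := R_NormedModule)); [|apply (is_RInt_cosh_exp_sinh (- kappa)); lra].
  intros t Ht; rewrite Rmin_left, Rmax_right in Ht by lra.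
  rewrite Rabs_left1; [f_equal; f_equal; ring|].
  rewrite <- sinh_0; apply sinh_le; lra.
- eapply (is_RInt_ext (V := R_NormedModule)); [|apply (is_RInt_cosh_exp_sinh kappa); lra].
  intros t Ht; rewrite Rmin_left, Rmax_right in Ht by lra.
  rewrite Rabs_pos_eq; [f_equal; f_equal; ring|].
  apply sinh_nonneg; lra.
Qed.

Lemma Zsum_opp (a b : Z) u : (a - 1 <= b)%Z ->
  Zsum a b u = Zsum (- b) (- a) (fun k => u (- k)%Z).
Proof.
intros Hab; pattern b, (Zsum a b u); apply Zsum_ind; auto.
- now rewrite Zsum_nil by lia.
- intros k s Hk ->.
  rewrite (Zsum_split (- k) (- k) (- a)), (Zsum_last (- k) (- k)), (Zsum_nil (- k) (- k - 1)) by lia.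
  rewrite Z.opp_involutive; replace (- k + 1)%Z with (- (k - 1))%Z by lia.
  ring.
Qed.

(** Uses e^s >= 1 + s at s = kappa (sinh(x + h) - sinh x); the increment of sinh over one step is at
    least h cosh P. *)
Lemma exp_sinh_step kappa h P x : 0 < kappa -> 0 <= h -> 0 <= P <= x ->
  exp (- (kappa * sinh (x + h))) * (kappa * h * cosh P) <=
  exp (- (kappa * sinh x)) - exp (- (kappa * sinh (x + h))).
Proof.
intros Hk Hh HPx.
assert (H1 : h * cosh P <= sinh (x + h) - sinh x).
{ rewrite sinh_plus.
  generalize (sinh_nonneg x ltac:(lra)) (cosh_ge_1 h) (sinh_ge_id h Hh)
    (cosh_le P x ltac:(lra) ltac:(lra)) (cosh_ge_1 P); intros.
  assert (h * cosh P <= sinh h * cosh x) by (apply Rmult_le_compat; lra).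
  nra. }
replace (exp (- (kappa * sinh x))) with
  (exp (- (kappa * sinh (x + h))) * exp (kappa * (sinh (x + h) - sinh x)))
  by (rewrite <- exp_plus; f_equal; ring).
assert (H2 := exp_ineq1_le (kappa * (sinh (x + h) - sinh x))).
assert (H3 : kappa * (h * cosh P) <= kappa * (sinh (x + h) - sinh x))
  by (apply Rmult_le_compat_l; lra).
rewrite <- (Rmult_1_r (exp (- (kappa * sinh (x + h))))) at 3.
rewrite <- Rmult_minus_distr_l; apply Rmult_le_compat_l; [left; apply exp_pos|lra].
Qed.

Lemma Zsum_exp_sinh_tail kappa h K (P m : Z) (u : Z -> C) :
  0 < kappa -> 0 < h -> 0 <= K -> (0 <= P <= m)%Z ->
  (forall k, (P < k)%Z -> Cmod (u k) <= K * exp (- (kappa * sinh (IZR k * h)))) ->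
  Cmod (Zsum (P + 1) m u) <=
  K * exp (- (kappa * sinh (IZR P * h))) / (kappa * h * cosh (IZR P * h)).
Proof.
intros Hk Hh HK HPm Hu.
assert (HP0 : 0 <= IZR P * h) by (apply Rmult_le_pos; [apply IZR_le; lia|lra]).
assert (Hc := cosh_ge_1 (IZR P * h)).
set (D := kappa * h * cosh (IZR P * h)).
assert (HD : 0 < D) by (unfold D; apply Rmult_lt_0_compat; [nra|lra]).
set (E := fun k : Z => exp (- (kappa * sinh (IZR k * h)))).
(* The telescoped form carries the induction; dropping [E m] makes the bound uniform in m. *)
apply Rle_trans with (K * (E P - E m) / D).
2:{ apply Rmult_le_compat_r; [left; now apply Rinv_0_lt_compat|].
    apply Rmult_le_compat_l; auto; generalize (exp_pos (- (kappa * sinh (IZR m * h)))).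
    unfold E; lra. }
pattern m, (Zsum (P + 1) m u); apply Zsum_ind; [| |lia].
- replace (P + 1 - 1)%Z with P by lia; rewrite Cmod_0; right; field; lra.
- intros k s Hkb IH; eapply Rle_trans; [apply Cmod_triangle|].
  apply Rle_trans with (K * (E P - E (k - 1)%Z) / D + K * E k).
  { apply Rplus_le_compat; auto; apply Hu; lia. }
  assert (H : E k * D <= E (k - 1)%Z - E k).
  { assert (Hkh : IZR k * h = IZR (k - 1) * h + h) by (rewrite minus_IZR; ring).
    unfold E, D; rewrite Hkh.
    apply exp_sinh_step; auto; try lra.
    split; auto; apply Rmult_le_compat_r; [lra|apply IZR_le; lia]. }
  apply Rmult_le_reg_r with D; auto.
  replace ((K * (E P - E (k - 1)%Z) / D + K * E k) * D) with (K * (E P - E (k - 1)%Z) + K * (E k * D))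
    by (field; lra).
  replace (K * (E P - E k) / D * D) with (K * (E P - E k)) by (field; lra).
  nra.
Qed.

Lemma Rabs_sinc_le_1 k h x : Rabs (sinc k h x) <= 1.
Proof.
unfold sinc; destruct Req_EM_T as [|_]; [rewrite Rabs_R1; lra|].
set (t := PI * (x / h - IZR k)).
(* In this branch t = 0 is possible only for h = 0; the quotient is then 0, being 0 times an
   inverse. *)
destruct (Req_dec t 0) as [->|Ht].
{ rewrite sin_0; unfold Rdiv; rewrite Rmult_0_l, Rabs_R0; lra. }
unfold Rdiv; rewrite Rabs_mult, Rabs_inv.
apply Rle_div_l; [now apply Rabs_pos_lt|rewrite Rmult_1_l; apply Rabs_sin_le_abs].
Qed.

Lemma sinc_truncation (F : C -> C) (h x K alpha beta : R) (M N m : Z) :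
  0 < h -> 0 <= K -> 0 < alpha -> 0 < beta ->
  (0 <= M <= m)%Z -> (0 <= N <= m)%Z ->
  (forall t, 0 <= t -> Cmod (F (RtoC t)) <= K * exp (- (PI / 2 * beta * sinh t))) ->
  (forall t, 0 <= t -> Cmod (F (RtoC (- t))) <= K * exp (- (PI / 2 * alpha * sinh t))) ->
  let u := fun k => (F (RtoC (IZR k * h)) * RtoC (sinc k h x))%C in
  Cmod (Zsum (- m) m u - Zsum (- M) N u) <=
  K * exp (- (PI / 2 * alpha * sinh (IZR M * h))) / (PI / 2 * alpha * h * cosh (IZR M * h)) +
  K * exp (- (PI / 2 * beta * sinh (IZR N * h))) / (PI / 2 * beta * h * cosh (IZR N * h)).
Proof.
intros Hh HK Ha Hb HM HN HFp HFn u; assert (HP := PI_RGT_0).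
rewrite (Zsum_split (- m) (- M - 1) m), (Zsum_split (- M - 1 + 1) N m) by lia.
replace (- M - 1 + 1)%Z with (- M)%Z by lia.
replace (Zsum (- m) (- M - 1) u + (Zsum (- M) N u + Zsum (N + 1) m u) - Zsum (- M) N u)%C
  with (Zsum (- m) (- M - 1) u + Zsum (N + 1) m u)%C by ring.
assert (Hu : forall k B, Cmod (F (RtoC (IZR k * h))) <= B -> Cmod (u k) <= B).
{ intros k B HB; unfold u; rewrite Cmod_mult, Cmod_R.
  generalize (Rabs_sinc_le_1 k h x) (Cmod_ge_0 (F (RtoC (IZR k * h)))); nra. }
eapply Rle_trans; [apply Cmod_triangle|]; apply Rplus_le_compat.
(* Reflecting k to - k turns the left tail into a right tail with alpha in place of beta. *)
- rewrite Zsum_opp by lia.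
  replace (- (- M - 1))%Z with (M + 1)%Z by lia; rewrite Z.opp_involutive.
  apply Zsum_exp_sinh_tail; auto; [nra|].
  intros k Hk; apply Hu; rewrite opp_IZR, Ropp_mult_distr_l_reverse; apply HFn.
  apply Rmult_le_pos; [apply IZR_le; lia|lra].
- apply Zsum_exp_sinh_tail; auto; [nra|].
  intros k Hk; apply Hu, HFp.
  apply Rmult_le_pos; [apply IZR_le; lia|lra].
Qed.

(** In the application Q = 4dn. From sinh y = (e^y - e^(-y)) / 2, kappa e^y >= Q and e^(-y) <= 1,
    the exponent is at most (pi/4)(nu - Q): this is the origin of e^(pi nu/4). The denominator uses
    cosh y >= e^y / 2. *)
Lemma tail_bound kappa h K y Q nu : 0 < kappa <= nu -> 0 < h -> 0 <= K -> 0 <= y ->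
  0 < Q -> Q <= kappa * exp y ->
  K * exp (- (PI / 2 * kappa * sinh y)) / (PI / 2 * kappa * h * cosh y) <=
  4 * K / (PI * h * Q) * (exp (PI * nu / 4) * exp (- (PI * Q / 4))).
Proof.
intros Hk Hh HK Hy HQ HQe; assert (HP := PI_RGT_0).
assert (Hch : exp y <= 2 * cosh y) by (unfold cosh; generalize (exp_pos (- y)); lra).
assert (He : exp (- (PI / 2 * kappa * sinh y)) <= exp (PI * nu / 4) * exp (- (PI * Q / 4))).
{ rewrite <- exp_plus.
  assert (Hexp : exp (- y) <= 1).
  { rewrite <- exp_0; destruct Hy as [Hy| <-]; [left; apply exp_increasing; lra|rewrite Ropp_0; lra]. }
  assert (Hle : - (PI / 2 * kappa * sinh y) <= PI * nu / 4 + - (PI * Q / 4)).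
  { replace (- (PI / 2 * kappa * sinh y)) with (PI / 4 * (kappa * exp (- y) - kappa * exp y))
      by (unfold sinh; field).
    replace (PI * nu / 4 + - (PI * Q / 4)) with (PI / 4 * (nu - Q)) by field.
    apply Rmult_le_compat_l; [lra|].
    generalize (exp_pos (- y)); nra. }
  destruct Hle as [Hlt| ->]; [left; now apply exp_increasing|lra]. }
assert (HD : PI * h * Q / 4 <= PI / 2 * kappa * h * cosh y).
{ replace (PI / 2 * kappa * h * cosh y) with (PI * h / 4 * (kappa * (2 * cosh y))) by field.
  replace (PI * h * Q / 4) with (PI * h / 4 * Q) by field.
  apply Rmult_le_compat_l; nra. }
assert (HQ0 : 0 < PI * h * Q / 4).
{ assert (0 < PI * h) by nra; nra. }
replace (4 * K / (PI * h * Q) * (exp (PI * nu / 4) * exp (- (PI * Q / 4))))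
  with (K * (exp (PI * nu / 4) * exp (- (PI * Q / 4))) * / (PI * h * Q / 4)) by (field; lra).
unfold Rdiv at 1; apply Rmult_le_compat.
- apply Rmult_le_pos; [lra|left; apply exp_pos].
- left; apply Rinv_0_lt_compat; lra.
- now apply Rmult_le_compat_l.
- now apply Rinv_le_contravar.
Qed.

(** * The error bound *)

(** F is controlled on the open strip only, so the contour has half-height c < d, and the bound is
    continuous in c. Half of [eps] pays for replacing c by d, the other half for the vertical
    sides. *)
Lemma discretization_limit (F : C -> C) (d h x A kappa eps : R) :
  0 < d -> 0 < h -> 0 <= A -> 0 < kappa -> 0 < eps ->
  (forall z, strip d z -> Cdiff F z) ->
  (forall z, strip d z -> Cmod (F z) <= A * exp (- (kappa * Rabs (sinh (fst z))))) ->
  exists m0 : nat, forall m : nat, (m0 <= m)%nat ->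
  Cmod (F (RtoC x) - Zsum (- Z.of_nat m) (Z.of_nat m)
    (fun k => F (RtoC (IZR k * h)) * RtoC (sinc k h x))%C) <=
  2 * A / kappa / (PI * d * sinh (PI * d / h)) + eps.
Proof.
intros Hd Hh HA Hk Heps HF HB; assert (HP := PI_RGT_0).
assert (Hsh : forall c, 0 < c -> 0 < sinh (PI * c / h)).
{ intros c Hc; rewrite <- sinh_0; apply sinh_lt, Rdiv_lt_0_compat; nra. }
set (phi := fun c => 2 * A / kappa / (PI * c * sinh (PI * c / h))).
assert (Hphi : continuous phi d).
{ apply (ex_derive_continuous phi); unfold phi, sinh; auto_derive.
  specialize (Hsh d Hd); unfold sinh, Rdiv in Hsh.
  repeat split; try lra.
  apply Rgt_not_eq; unfold Rdiv; apply Rmult_lt_0_compat; auto; nra. }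
destruct (proj1 (filterlim_locally phi (phi d)) Hphi (mkposreal (eps / 2) ltac:(lra))) as [delta Hdelta].
assert (Hdl := cond_pos delta).
(* Within [delta] of d, and kept positive by d/2. *)
set (c := Rmax (d / 2) (d - delta / 2)).
assert (Hc1 : d / 2 <= c) by apply Rmax_l.
assert (Hc2 : d - delta / 2 <= c) by apply Rmax_r.
assert (Hc3 : c < d) by (apply Rmax_lub_lt; lra).
assert (Hphic : phi c <= phi d + eps / 2).
{ assert (Hb : Rabs (phi c - phi d) < eps / 2).
  { apply (Hdelta c); change (Rabs (c - d) < delta); rewrite Rabs_left; lra. }
  apply Rabs_def2 in Hb; lra. }
(* Chosen so that T - |x| exceeds 4cA / (pi eps), which makes the vertical term 2cA / (pi (T - |x|))
   at most eps/2. *)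
destruct (INR_unbounded ((Rabs x + 4 * c * A / (PI * eps)) / h)) as [m0 Hm0].
exists m0; intros m Hm.
assert (Hmh : Rabs x + 4 * c * A / (PI * eps) < INR m * h).
{ apply Rlt_div_l; auto; eapply Rlt_le_trans; [apply Hm0|now apply le_INR]. }
assert (Hpe : 0 < PI * eps) by nra.
assert (HcA : 0 <= 4 * c * A / (PI * eps)) by (apply Rdiv_le_0_compat; nra).
set (T := (INR m + / 2) * h).
assert (HT : 4 * c * A / (PI * eps) < T - Rabs x) by (unfold T; lra).
assert (HTx : 0 < T - Rabs x) by lra.
assert (Hx := Rabs_pos x).
assert (HT0 : 0 <= T) by lra.
assert (Hstrip : forall z, Rabs (snd z) <= c -> strip d z)
  by (intros z Hz; unfold strip, Im; lra).
set (l := A * (2 * (1 - exp (- (kappa * sinh T))) / kappa)).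
assert (Hexp : 0 <= 1 - exp (- (kappa * sinh T)) <= 1).
{ split; [|generalize (exp_pos (- (kappa * sinh T))); lra].
  assert (Hle : - (kappa * sinh T) <= 0) by (generalize (sinh_nonneg T HT0); nra).
  rewrite <- exp_0; destruct Hle as [Hlt| ->]; [|lra].
  apply exp_increasing in Hlt; lra. }
assert (Hl : l <= 2 * A / kappa).
{ unfold l; replace (2 * A / kappa) with (A * (2 * 1 / kappa)) by (field; lra).
  apply Rmult_le_compat_l; auto; apply Rmult_le_compat_r; [left; now apply Rinv_0_lt_compat|lra]. }
assert (Hl0 : 0 <= l).
{ unfold l; apply Rmult_le_pos; auto; apply Rdiv_le_0_compat; lra. }
assert (HG : forall z, strip d z ->
  Cmod (F z) <= A * (cosh (fst z) * exp (- (kappa * Rabs (sinh (fst z)))))).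
{ intros z Hz; eapply Rle_trans; [now apply HB|]; apply Rmult_le_compat_l; auto.
  generalize (cosh_ge_1 (fst z)) (exp_pos (- (kappa * Rabs (sinh (fst z))))); nra. }
eapply Rle_trans.
- apply (sinc_discretization F c h x
    (fun t => A * (cosh t * exp (- (kappa * Rabs (sinh t))))) m T A l); auto; try lra.
  + intros z Hz; eapply Rle_trans; [now apply HB, Hstrip|].
    rewrite <- (Rmult_1_r A) at 2; apply Rmult_le_compat_l; auto.
    assert (Hle : - (kappa * Rabs (sinh (fst z))) <= 0)
      by (generalize (Rabs_pos (sinh (fst z))); nra).
    rewrite <- exp_0; destruct Hle as [Hlt| ->]; [left; now apply exp_increasing|lra].
  + intros t; apply (HG (t, c)), Hstrip; simpl; rewrite Rabs_pos_eq; lra.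
  + intros t; apply (HG (t, - c)), Hstrip; simpl; rewrite Rabs_left; lra.
  + apply (is_RInt_scal (V := R_NormedModule)
      (fun t => cosh t * exp (- (kappa * Rabs (sinh t))))).
    now apply is_RInt_cosh_exp_abs_sinh.
- assert (Hc0 : 0 < PI * c * sinh (PI * c / h)).
  { specialize (Hsh c ltac:(lra)); assert (0 < PI * c) by nra; nra. }
  assert (H1 : l / (PI * c * sinh (PI * c / h)) <= phi c).
  { unfold phi, Rdiv at 1 2; apply Rmult_le_compat_r; auto; left; now apply Rinv_0_lt_compat. }
  assert (H2 : 2 * c * A / (PI * (T - Rabs x)) <= eps / 2).
  { apply Rle_div_l; [nra|]; apply Rlt_div_l in HT; [|auto]; nra. }
  unfold phi in *; lra.
Qed.

(** 1 / sinh t = 2 e^(-t) / (1 - e^(-2t)), and this denominator increases with t. Taken with t0 = pi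
    mu e/4, it yields the factor 1 - e^(-pi mu e/2) of [C2]. *)
Lemma inv_sinh_le t t0 : 0 < t0 <= t ->
  / sinh t <= 2 * exp (- t) / (1 - exp (- (2 * t0))).
Proof.
intros Ht.
assert (E0 : exp (- (2 * t0)) < 1) by (rewrite <- exp_0; apply exp_increasing; lra).
assert (Et : exp (- (2 * t)) <= exp (- (2 * t0))).
{ destruct (proj2 Ht) as [Hlt| <-]; [left; apply exp_increasing; lra|lra]. }
assert (Es : sinh t = (1 - exp (- (2 * t))) / (2 * exp (- t))).
{ assert (Hp := exp_pos (- t)).
  replace (- (2 * t)) with (- t + - t) by ring; rewrite exp_plus; unfold sinh.
  replace (exp t) with (/ exp (- t)) by (rewrite exp_Ropp, Rinv_inv; auto).
  field; lra. }
rewrite Es; assert (Hp := exp_pos (- t)).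
replace (/ ((1 - exp (- (2 * t))) / (2 * exp (- t)))) with
  (2 * exp (- t) * / (1 - exp (- (2 * t)))) by (field; lra).
apply Rmult_le_compat_l; [lra|]; apply Rinv_le_contravar; lra.
Qed.

(** This is e^s >= 1 + s at s = log y - 1. At y = 4dn/mu it reads h <= 4d / (mu e). *)
Lemma ln_le_div_e y : 0 < y -> ln y <= y / exp 1.
Proof.
intros Hy; assert (H := exp_ineq1_le (ln y - 1)).
unfold Rminus in H; rewrite exp_plus, exp_ln, exp_Ropp in H by auto.
unfold Rdiv; lra.
Qed.

(** By monotonicity cos y is replaced by cos d in u, and |sin y| by sin d inside the cosine; alpha
    and beta are both lowered to mu, so that one exponent serves either sign of u. *)
Lemma strip_bound (F : C -> C) (d K alpha beta : R) (z : C) :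
  0 < d < PI / 2 -> 0 < K -> 0 < alpha -> 0 < beta -> strip d z ->
  Cmod (F z) <= K * normE2 alpha beta (Cpsi z) ->
  Cmod (F z) <= K / Rpower (cos (PI / 2 * sin d)) ((alpha + beta) / 2)
    * exp (- (PI / 2 * Rmin alpha beta * cos d * Rabs (sinh (fst z)))).
Proof.
intros Hd HK Ha Hb Hz HF; assert (HP := PI_RGT_0).
destruct z as [x y]; unfold strip, Im in Hz; simpl in Hz; simpl fst.
eapply Rle_trans; [apply HF|].
assert (Hcos : cos d <= cos y).
{ unfold Rabs in Hz; destruct Rcase_abs in Hz.
  - rewrite <- (cos_neg y); apply cos_decr_1; lra.
  - apply cos_decr_1; lra. }
assert (Hcd : 0 < cos d) by (apply cos_gt_0; lra).
assert (Hsin : Rabs (sin y) <= sin d).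
{ unfold Rabs in Hz; destruct Rcase_abs in Hz.
  - replace (Rabs (sin y)) with (Rabs (sin (- y))) by (now rewrite sin_neg, Rabs_Ropp).
    rewrite Rabs_pos_eq by (apply sin_ge_0; lra); apply sin_incr_1; lra.
  - rewrite Rabs_pos_eq by (apply sin_ge_0; lra); apply sin_incr_1; lra. }
assert (Hsd : sin d < 1) by (rewrite <- sin_PI2; apply sin_increasing_1; lra).
assert (Hsy := Rabs_pos (sin y)).
assert (Hq0 : 0 < cos (PI / 2 * sin d)) by (apply cos_gt_0; nra).
assert (Hq : cos (PI / 2 * sin d) <= cos (PI / 2 * Rabs (sin y))) by (apply cos_decr_1; nra).
assert (Hm1 := Rmin_l alpha beta); assert (Hm2 := Rmin_r alpha beta).
assert (Hm0 : 0 < Rmin alpha beta) by now apply Rmin_pos.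
set (mu := Rmin alpha beta) in *.
set (r := PI / 2 * mu * cos d * Rabs (sinh x)).
assert (Hkey : forall g, mu <= g -> r <= g * (PI / 2 * (Rabs (sinh x) * cos y))).
{ intros g Hg; unfold r.
  assert (Hsx := Rabs_pos (sinh x)).
  replace (PI / 2 * mu * cos d * Rabs (sinh x)) with (PI / 2 * Rabs (sinh x) * (mu * cos d)) by ring.
  replace (g * (PI / 2 * (Rabs (sinh x) * cos y))) with (PI / 2 * Rabs (sinh x) * (g * cos y)) by ring.
  apply Rmult_le_compat_l; [nra|]; apply Rmult_le_compat; lra. }
replace (K / Rpower (cos (PI / 2 * sin d)) ((alpha + beta) / 2) * exp (- r))
  with (K * (exp (- r) / Rpower (cos (PI / 2 * sin d)) ((alpha + beta) / 2)))
  by (unfold Rdiv; ring).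
apply Rmult_le_compat_l; [lra|].
apply normE2_le_exp; auto; [lra| |].
- intros Hu; assert (Hs : 0 <= sinh x).
  { apply Rnot_lt_le; intros Hs.
    assert (0 < (- sinh x) * cos y) by (apply Rmult_lt_0_compat; lra). nra. }
  generalize (Hkey beta Hm2); now rewrite Rabs_pos_eq.
- intros Hu; assert (Hs : sinh x <= 0).
  { apply Rnot_lt_le; intros Hs.
    assert (0 < sinh x * cos y) by (apply Rmult_lt_0_compat; lra). nra. }
  generalize (Hkey alpha Hm1); rewrite Rabs_left1 by auto; nra.
Qed.

(** At y = 0 the cosine factor is 1, so the tails carry the bare constant K, and each side keeps its
    own exponent. *)
Lemma real_line_bound (F : C -> C) (K alpha beta t : R) :
  0 < K -> 0 < alpha -> 0 < beta -> 0 <= t ->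
  (forall s, Cmod (F (RtoC s)) <= K * normE2 alpha beta (Cpsi (RtoC s))) ->
  Cmod (F (RtoC t)) <= K * exp (- (PI / 2 * beta * sinh t)) /\
  Cmod (F (RtoC (- t))) <= K * exp (- (PI / 2 * alpha * sinh t)).
Proof.
intros HK Ha Hb Ht HF; assert (HP := PI_RGT_0).
assert (Hst := sinh_nonneg t Ht).
assert (H1 : forall s r,
  (0 <= sinh s -> r <= PI / 2 * beta * sinh s) ->
  (sinh s <= 0 -> r <= - (PI / 2 * alpha * sinh s)) ->
  Cmod (F (RtoC s)) <= K * exp (- r)).
{ intros s r Hr1 Hr2; eapply Rle_trans; [apply HF|].
  apply Rmult_le_compat_l; [lra|].
  replace (exp (- r)) with (exp (- r) / Rpower 1 ((alpha + beta) / 2))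
    by (unfold Rpower; rewrite ln_1, Rmult_0_r, exp_0; field).
  apply normE2_le_exp; auto.
  - rewrite Rabs_R0; lra.
  - rewrite sin_0, Rabs_R0, Rmult_0_r, cos_0; lra.
  - rewrite cos_0, Rmult_1_r; intros Hu.
    specialize (Hr1 ltac:(apply Rmult_le_reg_l with (PI / 2); lra)); lra.
  - rewrite cos_0, Rmult_1_r; intros Hu.
    specialize (Hr2 ltac:(apply Rmult_le_reg_l with (PI / 2); lra)); lra. }
split; apply H1; rewrite ?sinh_opp; intros Hs; try lra;
  replace (sinh t) with 0 by lra; lra.
Qed.

Theorem theorem2p8 :
  forall (d K alpha beta : R) (f : R -> C) (F : C -> C),
  0 < d < PI / 2 ->
  0 < K -> 0 < alpha -> 0 < beta ->
  (* f is analytic in psi(D_d), with lift F = f o psi *)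
  (forall t : R, 0 < t -> f t = F (RtoC (psi_inv t))) ->
  (forall zeta : C, strip d zeta ->
     @ex_derive C_AbsRing C_NormedModule F zeta) ->
  (forall zeta : C, strip d zeta ->
     Cmod (F zeta) <= K * normE2 alpha beta (Cpsi zeta)) ->
  forall (mu nu : R),
  mu = Rmin alpha beta -> nu = Rmax alpha beta ->
  forall (n : nat) (h : R) (M N : Z),
  (0 < n)%nat ->
  h = step d mu n ->
  (mu = alpha ->
     M = Z.of_nat n /\ N = (Z.of_nat n - Zfloor (ln (beta / alpha) / h))%Z) ->
  (mu = beta ->
     N = Z.of_nat n /\ M = (Z.of_nat n - Zfloor (ln (alpha / beta) / h))%Z) ->
  INR n >= nu * exp 1 / (4 * d) ->
  Rbar_le
    (sup_pos (fun t : R =>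
       Cmod (f t - Zsum (- M) N (fun k : Z =>
                     f (psi (IZR k * h)) * RtoC (sinc k h (psi_inv t)))%C)%C))
    (Finite (C2 d K alpha beta
             * exp (- (PI * d * INR n / ln (4 * d * INR n / mu))))).
Proof.
intros d K alpha beta f F Hd HK Ha Hb Hf HF HB mu nu Hmu Hnu n h M N Hn Hh HMN1 HMN2 Hbig.
assert (HP := PI_RGT_0); assert (Hexp1 := exp_pos 1).
assert (Hmua : mu <= alpha) by (rewrite Hmu; apply Rmin_l).
assert (Hmub : mu <= beta) by (rewrite Hmu; apply Rmin_r).
assert (Hmu0 : 0 < mu) by (rewrite Hmu; now apply Rmin_pos).
assert (Hnua : alpha <= nu) by (rewrite Hnu; apply Rmax_l).
assert (Hnub : beta <= nu) by (rewrite Hnu; apply Rmax_r).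
assert (Hn0 : 0 < INR n) by now apply lt_0_INR.
set (Q := 4 * d * INR n).
assert (HQ : nu * exp 1 <= Q).
{ apply Rge_le, Rle_div_l in Hbig; [|lra]; unfold Q; lra. }
assert (HQ0 : 0 < Q) by nra.
set (L := ln (Q / mu)).
(* Q >= nu e >= mu e, by the condition on n. *)
assert (HL : 1 <= L).
{ unfold L; rewrite <- (ln_exp 1); apply ln_le; auto.
  apply Rle_div_r; auto; nra. }
assert (Hnh : INR n * h = L) by (rewrite Hh; unfold step; fold Q L; field; lra).
assert (Hh0 : 0 < h) by nra.
assert (HeL : exp L = Q / mu) by (apply exp_ln, Rdiv_lt_0_compat; auto).
(* Treats both orders of alpha and beta at once, a being the smaller exponent. Rounding down gives P
   h >= L - log(b/mu) = log(Q/b), so b e^(P h) >= Q; and Q >= nu e >= b e gives P h >= 1. *)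
assert (Hcut : forall a b : R, 0 < a -> 0 < b -> mu = a -> b <= nu ->
  0 <= IZR (Z.of_nat n) * h /\ Q <= a * exp (IZR (Z.of_nat n) * h) /\
  let P := (Z.of_nat n - Zfloor (ln (b / a) / h))%Z in
  0 <= IZR P * h /\ Q <= b * exp (IZR P * h)).
{ intros a b Ha0 Hb0 Hma Hbn; rewrite <- INR_IZR_INZ, Hnh, HeL, <- Hma.
  split; [lra|split; [right; field; lra|]]; intros P.
  assert (HPh : L - ln (b / mu) <= IZR P * h).
  { unfold P; rewrite minus_IZR, <- INR_IZR_INZ, Rmult_minus_distr_r, Hnh.
    assert (Hfl := proj1 (Zfloor_bound (ln (b / mu) / h))).
    apply Rle_div_r in Hfl; auto; lra. }
  assert (HLb : L - ln (b / mu) = ln (Q / b)).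
  { unfold L, Rdiv; rewrite !ln_mult, !ln_Rinv by (try apply Rinv_0_lt_compat; auto); ring. }
  rewrite HLb in HPh.
  assert (HQb : exp 1 <= Q / b) by (apply Rle_div_r; auto; nra).
  assert (H1 : 1 <= ln (Q / b)) by (rewrite <- (ln_exp 1); apply ln_le; auto).
  split; [lra|].
  apply Rle_trans with (b * exp (ln (Q / b))).
  - rewrite exp_ln by (apply Rdiv_lt_0_compat; auto); right; field; lra.
  - apply Rmult_le_compat_l; [lra|].
    destruct HPh as [Hlt| <-]; [left; now apply exp_increasing|lra]. }
assert (HMN : (0 <= IZR M * h /\ Q <= alpha * exp (IZR M * h)) /\
  0 <= IZR N * h /\ Q <= beta * exp (IZR N * h)).
{ destruct (Rle_dec alpha beta) as [Hab|Hab].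
  - rewrite Rmin_left in Hmu by auto.
    destruct (HMN1 Hmu) as [-> ->].
    generalize (Hcut alpha beta Ha Hb Hmu Hnub); tauto.
  - rewrite Rmin_right in Hmu by lra.
    destruct (HMN2 Hmu) as [-> ->].
    generalize (Hcut beta alpha Hb Ha Hmu Hnua); tauto. }
destruct HMN as [[HM0 HMQ] [HN0 HNQ]].
assert (HZ : forall P, 0 <= IZR P * h -> (0 <= P)%Z).
{ intros P H; apply le_IZR, Rmult_le_reg_r with h; lra. }
assert (Hd' : PI * Q / 4 = PI * d * INR n) by (unfold Q; field).
set (q := Rpower (cos (PI / 2 * sin d)) ((alpha + beta) / 2)).
assert (Hq : 0 < q) by apply exp_pos.
assert (Hcd : 0 < cos d) by (apply cos_gt_0; lra).
set (kappa := PI / 2 * mu * cos d).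
assert (Hkappa : 0 < kappa) by (unfold kappa; repeat first [lra | apply Rmult_lt_0_compat]).
assert (HFp : forall t, 0 <= t ->
  Cmod (F (RtoC t)) <= K * exp (- (PI / 2 * beta * sinh t)) /\
  Cmod (F (RtoC (- t))) <= K * exp (- (PI / 2 * alpha * sinh t))).
{ intros t Ht; apply real_line_bound; auto.
  intros s; apply HB; unfold strip, Im; simpl; rewrite Rabs_R0; lra. }
set (ex := exp (- (PI * d * INR n / L))).
assert (Hfinal : forall x, Cmod (F (RtoC x) -
  Zsum (- M) N (fun k => F (RtoC (IZR k * h)) * RtoC (sinc k h x))%C) <=
  C2 d K alpha beta * ex).
{ intros x; apply Rle_plus_epsilon; intros eps Heps.
  destruct (discretization_limit F d h x (K / q) kappa eps) as [m0 Hm0]; auto; try lra.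
  { apply Rdiv_le_0_compat; lra. }
  { intros z Hz; unfold kappa; rewrite Hmu; apply strip_bound; auto. }
  (* Large enough for the discretization bound, and for the full sum to contain the truncated
     one. *)
  set (m := Nat.max m0 (Z.to_nat (Z.max M N))).
  specialize (Hm0 m ltac:(lia)).
  assert (HMm := HZ M HM0); assert (HNm := HZ N HN0).
  assert (Htr := sinc_truncation F h x K alpha beta M N (Z.of_nat m) Hh0 ltac:(lra) Ha Hb
    ltac:(lia) ltac:(lia) (fun t Ht => proj1 (HFp t Ht)) (fun t Ht => proj2 (HFp t Ht))).
  cbv zeta in Htr.
  set (u := fun k : Z => (F (RtoC (IZR k * h)) * RtoC (sinc k h x))%C) in *.
  assert (HtM := tail_bound alpha h K (IZR M * h) Q nu ltac:(lra) Hh0 ltac:(lra) HM0 HQ0 HMQ).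
  assert (HtN := tail_bound beta h K (IZR N * h) Q nu ltac:(lra) Hh0 ltac:(lra) HN0 HQ0 HNQ).
  replace (F (RtoC x) - Zsum (- M) N u)%C with
    ((F (RtoC x) - Zsum (- Z.of_nat m) (Z.of_nat m) u) +
     (Zsum (- Z.of_nat m) (Z.of_nat m) u - Zsum (- M) N u))%C by ring.
  eapply Rle_trans; [apply Cmod_triangle|].
  assert (HhQ : h * Q = 4 * d * L) by (rewrite <- Hnh; unfold Q; ring).
  (* The tails are of order e^(-pi dn), and L >= 1 brings them to the common exponential. *)
  assert (Hex : exp (- (PI * Q / 4)) <= ex).
  { unfold ex; rewrite Hd'.
    assert (Hle : PI * d * INR n / L <= PI * d * INR n).
    { apply Rle_div_l; [lra|]; rewrite <- (Rmult_1_r (PI * d * INR n)) at 1.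
      apply Rmult_le_compat_l; [repeat first [lra | apply Rmult_le_pos]|auto]. }
    destruct Hle as [Hlt| ->]; [left; apply exp_increasing; lra|lra]. }
  (* Since h Q = 4dL, the prefactor is K / (pi d L), and 1/L <= 1. *)
  assert (Htail : 4 * K / (PI * h * Q) * (exp (PI * nu / 4) * exp (- (PI * Q / 4))) <=
    K / (PI * d) * exp (PI * nu / 4) * ex).
  { replace (PI * h * Q) with (PI * (h * Q)) by ring; rewrite HhQ.
    replace (PI * (4 * d * L)) with (4 * (PI * d * L)) by ring.
    replace (4 * K / (4 * (PI * d * L))) with (K / (PI * d) * / L) by (field; lra).
    rewrite (Rmult_assoc (K / (PI * d)) _ ex).
    assert (HKd : 0 <= K / (PI * d))
      by (apply Rdiv_le_0_compat; [lra|apply Rmult_lt_0_compat; lra]).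
    assert (HiL : / L <= 1) by (rewrite <- Rinv_1; apply Rinv_le_contravar; lra).
    assert (HiL0 : 0 < / L) by (apply Rinv_0_lt_compat; lra).
    apply Rmult_le_compat.
    - apply Rmult_le_pos; lra.
    - left; apply Rmult_lt_0_compat; apply exp_pos.
    - rewrite <- (Rmult_1_r (K / (PI * d))) at 2; now apply Rmult_le_compat_l.
    - apply Rmult_le_compat_l; auto; left; apply exp_pos. }
  assert (Hdisc : 2 * (K / q) / kappa / (PI * d * sinh (PI * d / h)) <=
    2 * K / (PI * d * mu) *
    (4 / (PI * (1 - exp (- (PI * mu * exp 1 / 2))) * q * cos d)) * ex).
  { assert (HLe : L <= Q / mu / exp 1) by (apply ln_le_div_e, Rdiv_lt_0_compat; auto).
    assert (Ht0 : PI * mu * exp 1 / 4 <= PI * d / h).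
    { apply (proj1 (Rle_div_r _ _ _ Hh0)).
      apply Rle_div_r in HLe; auto; apply Rle_div_r in HLe; auto.
      rewrite <- Hnh in HLe; unfold Q in HLe.
      assert (H4 : h * exp 1 * mu <= 4 * d).
      { apply Rmult_le_reg_l with (INR n); auto; lra. }
      replace (PI * mu * exp 1 / 4 * h) with (PI / 4 * (h * exp 1 * mu)) by field.
      replace (PI * d) with (PI / 4 * (4 * d)) by field.
      apply Rmult_le_compat_l; [lra|exact H4]. }
    assert (Ht0p : 0 < PI * mu * exp 1 / 4) by (apply Rdiv_lt_0_compat; [repeat first [lra | apply Rmult_lt_0_compat]|lra]).
    assert (Hinv := inv_sinh_le (PI * d / h) (PI * mu * exp 1 / 4) (conj Ht0p Ht0)).
    replace (2 * (PI * mu * exp 1 / 4)) with (PI * mu * exp 1 / 2) in Hinv by field.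
    replace (exp (- (PI * d / h))) with ex in Hinv.
    2:{ unfold ex; do 2 f_equal; rewrite <- Hnh; field; lra. }
    assert (He1 : exp (- (PI * mu * exp 1 / 2)) < 1)
      by (rewrite <- exp_0 at 2; apply exp_increasing; lra).
    assert (Hsh : 0 < sinh (PI * d / h)) by (rewrite <- sinh_0; apply sinh_lt; lra).
    replace (2 * (K / q) / kappa / (PI * d * sinh (PI * d / h))) with
      (4 * K / (PI * PI * d * mu * q * cos d) * / sinh (PI * d / h))
      by (unfold kappa; field; repeat split; lra).
    replace (2 * K / (PI * d * mu) *
      (4 / (PI * (1 - exp (- (PI * mu * exp 1 / 2))) * q * cos d)) * ex) with
      (4 * K / (PI * PI * d * mu * q * cos d) * (2 * ex / (1 - exp (- (PI * mu * exp 1 / 2)))))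
      by (field; repeat split; lra).
    apply Rmult_le_compat_l; auto.
    apply Rdiv_le_0_compat; [lra|repeat first [lra | apply Rmult_lt_0_compat]]. }
  (* The last factor 2 counts the two tails: together they give 2K / (pi d mu) times mu e^(pi
     nu/4). *)
  assert (HC2 : C2 d K alpha beta * ex =
    2 * K / (PI * d * mu) *
    (4 / (PI * (1 - exp (- (PI * mu * exp 1 / 2))) * q * cos d)) * ex +
    2 * (K / (PI * d) * exp (PI * nu / 4) * ex)).
  { unfold C2; cbv zeta; rewrite <- Hmu, <- Hnu; fold q.
    rewrite Rmult_plus_distr_l, Rmult_plus_distr_r; f_equal; field; lra. }
  rewrite HC2; lra. }
unfold sup_pos; apply (proj2 (Lub_Rbar_correct _)).
intros y [t [Ht ->]]; simpl.
rewrite Hf by auto.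
rewrite (Zsum_ext _ _ _ (fun k => F (RtoC (IZR k * h)) * RtoC (sinc k h (psi_inv t)))%C).
- apply Hfinal.
- intros k _; rewrite Hf by apply psi_pos; now rewrite psi_inv_psi.
Qed.
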